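(* Consider the following five classes of effectively inseparable pre-structures: (1) the e.i. Boolean pre-algebras; (2a) the e.i. Heyting pre-algebras; (2b) the e.i. free distributive pre-lattices on a countably infinite set of generators; (2c) the c.e. precomplete distributive (bounded) pre-lattices, including the e.i. pre-lattices of sentences of c.e. consistent extensions of Robinson's $Q$ or $R$; (3) the e.i. non-distributive pre-lattices. (The classes (2a), (2b), (2c) are subclasses of the class (2) of e.i. distributive pre-lattices.) Then for each pair $(\mathcal{A},\mathcal{B})$ of distinct classes among (1), (2a), (2b), (2c), (3) there is a pair of objects $(A,B)\in\mathcal{A}\times\mathcal{B}$ such that $A$ and $B$ are not computably isomorphic.
   Context: $W_u$, $\phi_e$ denote the $u$-th c.e. set and the $e$-th partial computable function. A c.e. pre-lattice is a structure $L=\langle\omega,\wedge,\vee,\leq_L\rangle$ with $\wedge,\vee$ computable binary operations and $\leq_L$ a c.e. pre-ordering (reflexive transitive) relation, such that the equivalence relation $\equiv_L$ ($x\equiv_L y$ iff $x\leq_L y$ and $y\leq_L x$) is a congruence and the quotient $L/{\equiv_L}$, ordered by the partial order induced by $\leq_L$, is a lattice in which $\wedge$ and $\vee$ induce meet and join. It is bounded, with constants $0,1$, if the classes $[0]_L,[1]_L$ are the least and greatest elements of the quotient. C.e. Boolean pre-algebras and c.e. Heyting pre-algebras are defined analogously, with all operations computable, $\leq_L$ c.e., $\equiv_L$ a congruence, and the quotient a Boolean, respectively Heyting, algebra. Distributive/non-distributive refers to the quotient lattice. All pre-orders are assumed non-trivial (quotient with more than one element). A disjoint pair $(A,B)$ of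 sets is effectively inseparable (e.i.) if there is a partial computable $\phi(u,v)$ such that whenever $A\subseteq W_u$, $B\subseteq W_v$, $W_u\cap W_v=\emptyset$, then $\phi(u,v)$ is defined and $\phi(u,v)\notin W_u\cup W_v$. An e.i. pre-lattice (Boolean pre-algebra, Heyting pre-algebra) is a c.e. bounded pre-lattice (Boolean pre-algebra, Heyting pre-algebra) $L$ such that $([0]_L,[1]_L)$ is e.i. A distributive (bounded) pre-lattice is free on a countably infinite set of generators if its quotient is a free bounded distributive lattice on a countably infinite set. $L$ is precomplete if $\equiv_L$ is non-trivial and there is a computable $f(e,x)$ such that for all $e,x$, if $\phi_e(x)$ is defined then $f(e,x)\equiv_L\phi_e(x)$. Pre-lattice of sentences: given a c.e. consistent theory $T$ and an infinite c.e. set $\mathcal{C}$ of sentences of its language closed under $\wedge,\vee$ and containing both a theorem and an anti-theorem (sentence whose negation is a theorem) of $T$, fix a computable bijection $\gamma:\mathcal{C}\to\omega$ with $\gamma^{-1}(0)$ an anti-theorem and $\gamma^{-1}(1)$ a theorem; the pre-lattice is $\langle\omega,\wedge,\vee,0,1,\leq\rangle$ with operations induced via $\gamma$ by the connectives, and $x\leq y$ iff $T\vdash\gamma^{-1}(x)\to\gamma^{-1}(y)$. A computable isomorphism between pre-structures $A,B$ is a computable function $f$ such that $x\leq_A y$ iff $f(x)\leq_B f(y)$ for all $x,y$, and $[x]_A\mapsto[f(x)]_B$ is an isomorphism of the quotient structures (compared as bounded lattices when the types differ). *)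

(* Defs.v *)
From Stdlib Require Cantor.
From mathcomp Require Import all_boot all_order.

Set Implicit Arguments.
Unset Strict Implicit.
Unset Printing Implicit Defensive.

Definition npair (x y : nat) : nat := Cantor.to_nat (x, y).
Definition nfst (n : nat) : nat := (Cantor.of_nat n).1.
Definition nsnd (n : nat) : nat := (Cantor.of_nat n).2.

(* The partial recursive functions from nat to nat, with Cantor pairing in
   place of arities. *)
Inductive code : Type :=
| CZero | CSucc | CFst | CSnd
| CPair (a b : code)
| CComp (a b : code)
| CPrec (a b : code)
| CMu (a : code).

(* In [eval_mu], [(k m).+1] is the (convergent, nonzero) value of [a] at
   [npair x m], for [m] below the least zero [n]. *)
Inductive eval : code -> nat -> nat -> Prop :=
| eval_zero x : eval CZero x 0
| eval_succ x : eval CSucc x x.+1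
| eval_fst x : eval CFst x (nfst x)
| eval_snd x : eval CSnd x (nsnd x)
| eval_pair a b x y z :
    eval a x y -> eval b x z -> eval (CPair a b) x (npair y z)
| eval_comp a b x y z :
    eval b x y -> eval a y z -> eval (CComp a b) x z
| eval_prec0 a b x y :
    eval a x y -> eval (CPrec a b) (npair x 0) y
| eval_precS a b x n y z :
    eval (CPrec a b) (npair x n) y -> eval b (npair x (npair n y)) z ->
    eval (CPrec a b) (npair x n.+1) z
| eval_mu a x n (k : nat -> nat) :
    (forall m, m < n -> eval a (npair x m) (k m).+1) ->
    eval a (npair x n) 0 -> eval (CMu a) x n.

(* A bijective Goedel numbering of [code]. *)
Fixpoint encode (c : code) : nat :=
  match c with
  | CZero => 0
  | CSucc => 1
  | CFst => 2
  | CSnd => 3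
  | CPair a b => 4 + (4 * npair (encode a) (encode b))
  | CComp a b => 5 + (4 * npair (encode a) (encode b))
  | CPrec a b => 6 + (4 * npair (encode a) (encode b))
  | CMu a => 7 + (4 * encode a)
  end.

(* [phi e x y]: the [e]-th partial computable function is defined at [x], with
   value [y]. *)
Definition phi (e x y : nat) : Prop := exists2 c, encode c = e & eval c x y.

Definition W (e x : nat) : Prop := exists y, phi e x y.

Definition computable (f : nat -> nat) : Prop :=
  exists e, forall x, phi e x (f x).

Definition computable2 (f : nat -> nat -> nat) : Prop :=
  exists e, forall x y, phi e (npair x y) (f x y).

Definition ce_rel (R : nat -> nat -> Prop) : Prop :=
  exists e, forall x y, R x y <-> W e (npair x y).

Definition effectively_inseparable (A B : nat -> Prop) : Prop :=
  (forall x, A x -> B x -> False) /\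
  exists p, forall u v,
    (forall x, A x -> W u x) -> (forall x, B x -> W v x) ->
    (forall x, W u x -> W v x -> False) ->
    exists2 n, phi p (npair u v) n & ~ W u n /\ ~ W v n.

(* Pre-structures have domain nat; their constants 0 and 1 are the numbers 0
   and 1. *)

Record lat_sig := LatSig {
  lmeet : nat -> nat -> nat;
  ljoin : nat -> nat -> nat;
  lle : nat -> nat -> Prop }.

Record bool_sig := BoolSig {
  bool_lat :> lat_sig;
  bneg : nat -> nat }.

Record heyting_sig := HeytingSig {
  heyting_lat :> lat_sig;
  himp : nat -> nat -> nat }.

Definition lequiv (L : lat_sig) (x y : nat) : Prop := lle L x y /\ lle L y x.

Definition congruent1 (L : lat_sig) (f : nat -> nat) : Prop :=
  forall x x', lequiv L x x' -> lequiv L (f x) (f x').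

Definition congruent2 (L : lat_sig) (f : nat -> nat -> nat) : Prop :=
  forall x x' y y', lequiv L x x' -> lequiv L y y' ->
    lequiv L (f x y) (f x' y').

Definition nontrivial (L : lat_sig) : Prop := exists x y, ~ lequiv L x y.

Record ce_prelattice (L : lat_sig) : Prop := {
  lmeet_computable : computable2 (lmeet L);
  ljoin_computable : computable2 (ljoin L);
  lle_ce : ce_rel (lle L);
  lle_refl : forall x, lle L x x;
  lle_trans : forall x y z, lle L x y -> lle L y z -> lle L x z;
  lmeet_congruent : congruent2 L (lmeet L);
  ljoin_congruent : congruent2 L (ljoin L);
  lmeet_glb : forall x y z, lle L z (lmeet L x y) <-> lle L z x /\ lle L z y;
  ljoin_lub : forall x y z, lle L (ljoin L x y) z <-> lle L x z /\ lle L y z;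
  lle_nontrivial : nontrivial L }.

Definition ce_bounded_prelattice (L : lat_sig) : Prop :=
  ce_prelattice L /\ forall x, lle L 0 x /\ lle L x 1.

Definition distributive (L : lat_sig) : Prop :=
  forall x y z, lequiv L (lmeet L x (ljoin L y z))
                            (ljoin L (lmeet L x y) (lmeet L x z)).

Definition ce_boolean_prealgebra (B : bool_sig) : Prop :=
  [/\ ce_bounded_prelattice B, distributive B,
      computable (bneg B), congruent1 B (bneg B)
    & forall x, lequiv B (lmeet B x (bneg B x)) 0 /\
                lequiv B (ljoin B x (bneg B x)) 1].

Definition ce_heyting_prealgebra (H : heyting_sig) : Prop :=
  [/\ ce_bounded_prelattice H, computable2 (himp H), congruent2 H (himp H)
    & forall x y z, lle H z (himp H x y) <-> lle H (lmeet H z x) y].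

Definition ei_bounds (L : lat_sig) : Prop :=
  effectively_inseparable (lequiv L 0) (lequiv L 1).

Definition ei_prelattice (L : lat_sig) : Prop :=
  ce_bounded_prelattice L /\ ei_bounds L.

Definition precomplete (L : lat_sig) : Prop :=
  nontrivial L /\
  exists2 f, computable2 f &
    forall e x y, phi e x y -> lequiv L (f e x) y.

(* [F] induces a homomorphism of bounded lattices from the quotient of [L]
   to [M]. *)
Definition quotient_hom (L : lat_sig) (d : Order.disp_t) (M : tbLatticeType d)
    (F : nat -> M) : Prop :=
  [/\ forall x y, lequiv L x y -> F x = F y,
      forall x y, F (lmeet L x y) = Order.meet (F x) (F y),
      forall x y, F (ljoin L x y) = Order.join (F x) (F y),
      F 0 = Order.bottom
    & F 1 = Order.top].

(* The quotient of [L] is a bounded distributive lattice, free on the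
   countably infinite set of classes of the [g n]. *)
Definition free_distributive (L : lat_sig) : Prop :=
  distributive L /\
  exists g : nat -> nat,
    (forall m n, lequiv L (g m) (g n) -> m = n) /\
    forall (d : Order.disp_t) (M : tbDistrLatticeType d) (h : nat -> M),
      (exists2 F : nat -> M, quotient_hom L F & forall n, F (g n) = h n) /\
      (forall F G : nat -> M, quotient_hom L F -> quotient_hom L G ->
         (forall n, F (g n) = h n) -> (forall n, G (g n) = h n) ->
         forall x, F x = G x).

Definition ei_boolean (B : bool_sig) : Prop :=
  ce_boolean_prealgebra B /\ ei_bounds B.

Definition ei_heyting (H : heyting_sig) : Prop :=
  ce_heyting_prealgebra H /\ ei_bounds H.

Definition ei_distributive (L : lat_sig) : Prop :=
  ei_prelattice L /\ distributive L.

Definition ei_free_distributive (L : lat_sig) : Prop :=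
  ei_prelattice L /\ free_distributive L.

Definition ce_precomplete_distributive (L : lat_sig) : Prop :=
  [/\ ce_bounded_prelattice L, distributive L & precomplete L].

Definition ei_nondistributive (L : lat_sig) : Prop :=
  ei_prelattice L /\ ~ distributive L.

Inductive class_name : Type :=
| Boolean | Heyting | FreeDistributive | PrecompleteDistributive
| NonDistributive.

Definition signature (c : class_name) : Type :=
  match c with
  | Boolean => bool_sig
  | Heyting => heyting_sig
  | FreeDistributive | PrecompleteDistributive | NonDistributive => lat_sig
  end.

Definition in_class (c : class_name) : signature c -> Prop :=
  match c with
  | Boolean => ei_boolean
  | Heyting => ei_heyting
  | FreeDistributive => ei_free_distributive
  | PrecompleteDistributive => ce_precomplete_distributive
  | NonDistributive => ei_nondistributive
  end.

Definition lattice_reduct (c : class_name) : signature c -> lat_sig :=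
  match c with
  | Boolean => bool_lat
  | Heyting => heyting_lat
  | FreeDistributive | PrecompleteDistributive | NonDistributive => id
  end.

Arguments in_class c A : clear implicits.
Arguments lattice_reduct c A : clear implicits.

Definition computably_isomorphic (A B : lat_sig) : Prop :=
  exists f : nat -> nat,
    [/\ computable f,
        forall x y, lle A x y <-> lle B (f x) (f y),
        forall y, exists x, lequiv B (f x) y,
        forall x y, lequiv B (f (lmeet A x y)) (lmeet B (f x) (f y)) /\
                    lequiv B (f (ljoin A x y)) (ljoin B (f x) (f y))
      & lequiv B (f 0) 0 /\ lequiv B (f 1) 1].

(* Main.v *)
Require Import Defs.
From Stdlib Require Cantor.
From mathcomp Require Import all_boot all_order zify.
From mathcomp.classical Require Import boolp.
Import Order.Theory.

Set Implicit Arguments.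
Unset Strict Implicit.
Unset Printing Implicit Defensive.

(** Three properties of the quotient order, preserved by every isomorphism,
    tell the classes apart: being complemented, having zero divisors (nonzero
    elements with meet 0), and being distributive.

    All objects are built in the same way.  The elements are terms over
    generators [tgen e k], one for each computation of the [e]-th partial
    computable function at [k], and the order is the least pre-order that
    satisfies the laws of the class together with [tgen e k = i] whenever the
    computation ends with a value [i] in {0, 1}.  This last law makes the bounds
    effectively inseparable ([effectively_inseparable_diag]): given disjoint
    c.e. supersets [W u] and [W v] of the classes of 0 and 1, let [e] be a
    program that waits until its own [tgen e k] shows up in [W u] or in [W v],
    and answers 1 in the first case and 0 in the second; then [tgen e k] lies in
    neither set.  If the law is imposed for all values [i], the pre-lattice is
    precomplete, and conversely the same program shows that every precomplete
    bounded pre-lattice is effectively inseparable ([precomplete_ei_bounds]).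

    The order is c.e. because a set inductively generated by semidecidable rules
    is semidecidable ([sigma1_generated]); the same lemma, applied to the
    evaluation of codes, yields the universal function ([sigma1_phi]).

    That the bounds stay distinct, and the failure of the three properties, are
    read off from models.
    - The Boolean pre-algebra has the excluded middle as an additional law; it
      is complemented, and undetermined generators are zero divisors.  With its
      implication it is also a Heyting pre-algebra, which serves for the classes
      other than the Boolean one.
    - The Heyting pre-algebra without further laws is not complemented, by a
      Kripke model with two worlds.
    - In the free distributive pre-lattice, the generators that no computation
      makes 0 or 1 are free generators.  It has no zero divisors: a term that is
      false when all of them are true is 0.
    - The precomplete pre-lattice gets two further generators with meet 0, hence
      zero divisors.  It has models because terms are monotone, so that the
      system of equations between generators and terms has a least solution in
      truth values; comparing the solutions for two values of a further
      generator shows that this generator has no complement.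
    - Without the distributive law, the modular lattice with three atoms is a
      model. *)

(** * Pairing *)

Lemma nfst_npair x y : nfst (npair x y) = x.
Proof. by rewrite /nfst /npair Cantor.cancel_of_to. Qed.

Lemma nsnd_npair x y : nsnd (npair x y) = y.
Proof. by rewrite /nsnd /npair Cantor.cancel_of_to. Qed.

Lemma npair_surj z : npair (nfst z) (nsnd z) = z.
Proof.
by rewrite /nfst /nsnd /npair -surjective_pairing Cantor.cancel_to_of.
Qed.

Lemma npair_inj x y x' y' : npair x y = npair x' y' -> x = x' /\ y = y'.
Proof.
move=> e; split.
  by rewrite -(nfst_npair x y) e nfst_npair.
by rewrite -(nsnd_npair x y) e nsnd_npair.
Qed.

Lemma leq_npair x y : x + y <= npair x y.
Proof. by have := Cantor.to_nat_non_decreasing x y; rewrite /npair; lia. Qed.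

Lemma leq_nfst z : nfst z <= z.
Proof. by have := leq_npair (nfst z) (nsnd z); rewrite npair_surj; lia. Qed.

Lemma leq_nsnd z : nsnd z <= z.
Proof. by have := leq_npair (nfst z) (nsnd z); rewrite npair_surj; lia. Qed.

Lemma ltn_nsnd z : 0 < z -> nsnd z < z.
Proof.
move=> z0; have := Cantor.to_nat_spec (nfst z) (nsnd z).
have -> : Cantor.to_nat (nfst z, nsnd z) = z by exact: npair_surj.
have := leq_nsnd z; rewrite leq_eqVlt => /predU1P[e|//]; rewrite e; nia.
Qed.

(** Numbers as lists, by iterated pairing: [field i z] is the entry number [i]
    of [z], and is 0 beyond the end. *)
Definition pack (s : seq nat) : nat := foldr npair 0 s.
Definition field (i z : nat) : nat := nfst (iter i nsnd z).

Lemma iterS_nsnd i x z : iter i.+1 nsnd (npair x z) = iter i nsnd z.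
Proof. by rewrite iterSr nsnd_npair. Qed.

Lemma field0 x z : field 0 (npair x z) = x.
Proof. exact: nfst_npair. Qed.

Lemma fieldS i x z : field i.+1 (npair x z) = field i z.
Proof. by rewrite /field iterS_nsnd. Qed.

Definition fieldE := (field0, fieldS).

Lemma iter_nsnd0 i : iter i nsnd 0 = 0.
Proof. by elim: i => //= i ->. Qed.

Lemma iter_nsnd_self z : iter z nsnd z = 0.
Proof.
have H n : iter n nsnd z <= z - n.
  elim: n => [|n IH] /=; first by rewrite subn0.
  have [e|] := posnP (iter n nsnd z); first by rewrite e.
  by move=> /ltn_nsnd; lia.
by have := H z; rewrite subnn leqn0 => /eqP.
Qed.

(** * Codes and evaluation *)

Lemma encode_inj : injective encode.
Proof.
elim=> [||||a IHa b IHb|a IHa b IHb|a IHa b IHb|a IHa]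
  [||||a' b'|a' b'|a' b'|a'] //=; try lia; move=> e.
1-3: have /npair_inj[/IHa -> /IHb ->] // : npair (encode a) (encode b) =
  npair (encode a') (encode b') by lia.
by congr CMu; apply: IHa; lia.
Qed.

Lemma encode_surj e : exists c, encode c = e.
Proof.
have [n] := ubnP e; elim: n e => // n IH e lt_en.
case: e lt_en => [|[|[|[|e]]]] lt_en.
- by exists CZero.
- by exists CSucc.
- by exists CFst.
- by exists CSnd.
have := divn_eq e 4; have := ltn_pmod e (isT : 0 < 4).
have := leq_nfst (e %/ 4); have := leq_nsnd (e %/ 4).
case: (IH (nfst (e %/ 4))) => [|a Ha]; first by have := leq_nfst (e %/ 4); lia.
case: (IH (nsnd (e %/ 4))) => [|b Hb]; first by have := leq_nsnd (e %/ 4); lia.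
case: (IH (e %/ 4)) => [|c Hc]; first by lia.
have := npair_surj (e %/ 4).
case: (e %% 4) => [|[|[|[|//]]]] Hp _ _ _ He.
- by exists (CPair a b); rewrite /= Ha Hb Hp; lia.
- by exists (CComp a b); rewrite /= Ha Hb Hp; lia.
- by exists (CPrec a b); rewrite /= Ha Hb Hp; lia.
- by exists (CMu c); rewrite /= Hc; lia.
Qed.

Ltac npair_eq :=
  match goal with e : npair _ _ = npair _ _ |- _ => case/npair_inj: e end.

Lemma eval_det c x y : eval c x y -> forall y', eval c x y' -> y = y'.
Proof.
elim=> {c x y}.
- by move=> x y' H; inversion H.
- by move=> x y' H; inversion H.
- by move=> x y' H; inversion H.
- by move=> x y' H; inversion H.
- move=> a b x y z _ IHa _ IHb y' H.
  inversion H as [| | | |a0 b0 x0 y0 z0 Ha Hb| | | |]; subst.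
  by rewrite (IHa _ Ha) (IHb _ Hb).
- move=> a b x y z _ IHb _ IHa y' H.
  inversion H as [| | | | |a0 b0 x0 y0 z0 Hb Ha| | |]; subst.
  by apply: IHa; rewrite (IHb _ Hb).
- move=> a b x y _ IH y'; move E: (npair x 0) => t H.
  inversion H as [| | | | | |a0 b0 x0 y0 Ha|a0 b0 x0 n0 y0 z0 Ha Hb|]; subst.
    by npair_eq => e _; apply: IH; rewrite -e.
  by npair_eq.
- move=> a b x n y z _ IHa _ IHb y'; move E: (npair x n.+1) => t H.
  inversion H as [| | | | | |a0 b0 x0 y0 Ha|a0 b0 x0 n0 y0 z0 Ha Hb|]; subst.
    by npair_eq.
  npair_eq => ? [?]; subst.
  by apply: IHb; rewrite (IHa _ Ha).
- move=> a x n k Hk IHk Hn IHn y' H.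
  inversion H as [| | | | | | | |a0 x0 n0 k0 pos zer]; subst.
  case: (ltngtP n y') => // lt.
    by have := IHn _ (pos _ lt).
  by have := IHk _ lt _ zer.
Qed.

Lemma phi_det e x y y' : phi e x y -> phi e x y' -> y = y'.
Proof. by move=> [c <- H] [c' /encode_inj -> H']; exact: eval_det H _ H'. Qed.

(** * Total computable functions *)

(** The total functions computed by a code.  Functions of several arguments are
    handled as functions of an argument [z] from which they are projected. *)
Definition total_rec (f : nat -> nat) : Prop :=
  exists c, forall x, eval c x (f x).

Lemma total_rec_ext f g : f =1 g -> total_rec f -> total_rec g.
Proof. by move=> fg [c H]; exists c => x; rewrite -fg. Qed.

Lemma nfst_total_rec : total_rec nfst.
Proof. by exists CFst => x; constructor. Qed.

Lemma nsnd_total_rec : total_rec nsnd.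
Proof. by exists CSnd => x; constructor. Qed.

Lemma total_rec_comp g f :
  total_rec g -> total_rec f -> total_rec (fun z => g (f z)).
Proof.
move=> [cg Hg] [cf Hf]; exists (CComp cg cf) => x.
by apply: eval_comp (Hf x) _.
Qed.

Lemma total_rec_fst f : total_rec f -> total_rec (fun z => nfst (f z)).
Proof. exact: total_rec_comp nfst_total_rec. Qed.

Lemma total_rec_snd f : total_rec f -> total_rec (fun z => nsnd (f z)).
Proof. exact: total_rec_comp nsnd_total_rec. Qed.

Lemma total_rec_succ f : total_rec f -> total_rec (fun z => (f z).+1).
Proof. by apply: total_rec_comp; exists CSucc => x; constructor. Qed.

Lemma total_rec_pair f g :
  total_rec f -> total_rec g -> total_rec (fun z => npair (f z) (g z)).
Proof.
move=> [cf Hf] [cg Hg]; exists (CPair cf cg) => x.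
by constructor.
Qed.

Lemma total_rec_id : total_rec (fun z => z).
Proof.
apply: (total_rec_ext (f := fun z => npair (nfst z) (nsnd z))).
  exact: npair_surj.
by apply: total_rec_pair; [exact: nfst_total_rec | exact: nsnd_total_rec].
Qed.

Lemma total_rec_const k : total_rec (fun=> k).
Proof.
elim: k => [|k IH]; last exact: total_rec_succ.
by exists CZero => x; constructor.
Qed.

Lemma total_rec_rec g h n : total_rec g -> total_rec h -> total_rec n ->
  total_rec (fun z =>
    nat_rect _ (g z) (fun m r => h (npair z (npair m r))) (n z)).
Proof.
move=> [cg Hg] [ch Hh] [cn Hn]; have [ci Hi] := total_rec_id.
exists (CComp (CPrec cg ch) (CPair ci cn)) => z.
apply: (eval_comp (y := npair z (n z))); first by constructor.
elim: (n z) => [|m IH] /=; first by constructor.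
exact: eval_precS IH _.
Qed.

#[local] Hint Resolve total_rec_id total_rec_const total_rec_fst total_rec_snd
  total_rec_succ total_rec_pair : trec.
#[local] Hint Extern 2 (total_rec (fun z => ?d (@?f z))) =>
  match goal with H : total_rec d |- _ => apply: (total_rec_comp H (f := f)) end
  : trec.

Lemma total_rec_iter h f n : total_rec h -> total_rec f -> total_rec n ->
  total_rec (fun z => iter (n z) h (f z)).
Proof.
move=> Hh Hf Hn.
apply: (total_rec_ext (f := fun z =>
  nat_rect _ (f z) (fun m r => h (nsnd (nsnd (npair z (npair m r))))) (n z))).
  by move=> z; elim: (n z) => //= m ->; rewrite !nsnd_npair.
apply: (total_rec_rec Hf (h := fun t => h (nsnd (nsnd t)))) => //.
by apply: (total_rec_comp Hh); auto with trec.
Qed.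

Lemma total_rec_add f g :
  total_rec f -> total_rec g -> total_rec (fun z => f z + g z).
Proof.
move=> Hf Hg.
apply: (total_rec_ext (f := fun z => iter (g z) S (f z))).
  by move=> z; rewrite iter_succn.
apply: total_rec_iter => //; exists CSucc => x; constructor.
Qed.

#[local] Hint Resolve total_rec_iter total_rec_add : trec.

Lemma total_rec_mul f g :
  total_rec f -> total_rec g -> total_rec (fun z => f z * g z).
Proof.
move=> Hf Hg.
apply: (total_rec_ext (f := fun z =>
  nat_rect _ 0 (fun m r => (fun t => nsnd (nsnd t) + f (nfst t))
    (npair z (npair m r))) (g z))).
  move=> z; elim: (g z) => [|m /= ->]; rewrite ?muln0 //.
  by rewrite !nsnd_npair nfst_npair mulnS addnC.
by apply: (total_rec_rec (g := fun=> 0)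
  (h := fun t => nsnd (nsnd t) + f (nfst t))); auto with trec.
Qed.

Lemma total_rec_sub f g :
  total_rec f -> total_rec g -> total_rec (fun z => f z - g z).
Proof.
move=> Hf Hg.
have pred_rec : total_rec predn.
  apply: (total_rec_ext (f := fun z =>
    nat_rect _ 0 (fun m r => nfst (nsnd (npair z (npair m r)))) z)).
    by case=> //= m; rewrite nsnd_npair nfst_npair.
  by apply: (total_rec_rec (h := fun t => nfst (nsnd t))); auto with trec.
apply: (total_rec_ext (f := fun z => iter (g z) predn (f z))).
  by move=> z; elim: (g z) => [|m IH]; rewrite ?subn0 //= IH subnS.
exact: total_rec_iter.
Qed.

Lemma total_rec_field i f : total_rec f -> total_rec (fun z => field i (f z)).
Proof.
move=> Hf; apply/total_rec_fst/total_rec_iter; auto with trec.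
Qed.

#[local] Hint Resolve total_rec_mul total_rec_sub
  total_rec_field : trec.

Lemma computable2P f :
  total_rec (fun z => f (nfst z) (nsnd z)) -> computable2 f.
Proof.
move=> [c H]; exists (encode c) => x y; exists c => //.
by have := H (npair x y); rewrite nfst_npair nsnd_npair.
Qed.

(** * Semidecidable predicates *)

(** A predicate in [Sigma_1] normal form; the value 0 of the matrix stands for
    truth. *)
Definition sigma1 (S : nat -> Prop) : Prop :=
  exists2 d, total_rec d & forall x, S x <-> exists s, d (npair x s) = 0.

Lemma sigma1_iff S S' : (forall x, S x <-> S' x) -> sigma1 S -> sigma1 S'.
Proof.
move=> SS' [d Hd H]; exists d => // x.
by rewrite -SS'.
Qed.

Lemma sigma1_comp S f : sigma1 S -> total_rec f -> sigma1 (fun x => S (f x)).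
Proof.
move=> [d Hd H] Hf; exists (fun z => d (npair (f (nfst z)) (nsnd z))).
  by auto with trec.
move=> x; rewrite H; split=> -[s Hs]; exists s; move: Hs;
by rewrite nfst_npair nsnd_npair.
Qed.

Lemma sigma1_eq f g :
  total_rec f -> total_rec g -> sigma1 (fun x => f x = g x).
Proof.
move=> Hf Hg.
exists (fun z => (f (nfst z) - g (nfst z)) + (g (nfst z) - f (nfst z))).
  by auto 7 with trec.
move=> x; split=> [e|[s]]; first by exists 0; rewrite nfst_npair; lia.
by rewrite nfst_npair; lia.
Qed.

Lemma sigma1_and S T : sigma1 S -> sigma1 T -> sigma1 (fun x => S x /\ T x).
Proof.
move=> [d Hd HS] [e He HT].
exists (fun z => d (npair (nfst z) (nfst (nsnd z)))
               + e (npair (nfst z) (nsnd (nsnd z)))).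
  by auto 7 with trec.
move=> x; rewrite HS HT; split=> [[[s Hs] [t Ht]]|[s]].
  by exists (npair s t); rewrite !(nfst_npair, nsnd_npair) Hs Ht.
rewrite !(nfst_npair, nsnd_npair) => H.
by split; [exists (nfst s) | exists (nsnd s)]; lia.
Qed.

Lemma sigma1_or S T : sigma1 S -> sigma1 T -> sigma1 (fun x => S x \/ T x).
Proof.
move=> [d Hd HS] [e He HT].
exists (fun z => d z * e z); first by auto with trec.
move=> x; rewrite HS HT; split=> [[[s Hs]|[s Hs]]|[s /eqP]].
- by exists s; rewrite Hs.
- by exists s; rewrite Hs muln0.
by rewrite muln_eq0 => /orP[]/eqP; [left|right]; exists s.
Qed.

Lemma sigma1_ex (P : nat -> nat -> Prop) :
  sigma1 (fun z => P (nfst z) (nsnd z)) -> sigma1 (fun x => exists y, P x y).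
Proof.
move=> [d Hd H].
exists (fun z => d (npair (npair (nfst z) (nfst (nsnd z))) (nsnd (nsnd z)))).
  by auto 7 with trec.
move=> x; split=> [[y]|[s]].
  have := H (npair x y); rewrite nfst_npair nsnd_npair => -> [s Hs].
  by exists (npair y s); rewrite !(nfst_npair, nsnd_npair).
rewrite !(nfst_npair, nsnd_npair) => Hs; exists (nfst s).
have := H (npair x (nfst s)); rewrite nfst_npair nsnd_npair => ->.
by exists (nsnd s).
Qed.

(** One of the two constant matrices does, by excluded middle. *)
Lemma sigma1_const (P : Prop) : sigma1 (fun=> P).
Proof.
case: (pselect P) => HP.
  exists (fun=> 0); auto with trec; by move=> x; split=> // _; exists 0.
exists (fun=> 1); auto with trec; by move=> x; split=> // -[].
Qed.

Lemma eval_search c d x s : (forall z, eval c z (d z)) ->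
  d (npair x s) = 0 -> exists2 n, eval (CMu c) x n & d (npair x n) = 0.
Proof.
move=> Hc Hs.
have ex : exists s, d (npair x s) == 0 by exists s; apply/eqP.
case: (ex_minnP ex) => n /eqP Hn Hmin; exists n => //.
apply: (@eval_mu _ _ _ (fun m => (d (npair x m)).-1)).
  move=> m lt_mn; rewrite prednK ?lt0n; first exact: Hc.
  by apply: contraTN lt_mn => /Hmin; rewrite -leqNgt.
by rewrite -[in X in eval _ _ X]Hn.
Qed.

(** Unbounded search turns a [Sigma_1] normal form into a domain. *)
Lemma sigma1_W S : sigma1 S -> exists e, forall x, S x <-> W e x.
Proof.
move=> [d [c Hc] H]; exists (encode (CMu c)) => x; rewrite H; split.
  by move=> [s /(eval_search Hc)[n Hn _]]; exists n; exists (CMu c).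
case=> y [c' /encode_inj -> ev].
inversion ev as [| | | | | | | |a z n k pos zer]; subst.
by exists y; exact: eval_det (Hc _) _ zer.
Qed.

(** * Inductively generated predicates *)

(** The least predicate that holds at 0 and is closed under the two-premise
    rules [R a b q] (from [a] and [b] infer [q]). *)
Inductive generated (R : nat -> nat -> nat -> Prop) : nat -> Prop :=
| generated0 : generated R 0
| generated_rule a b q :
    generated R a -> generated R b -> R a b q -> generated R q.

(** A derivation is a list of lines, the last line first.  The derivation
    [npair (npair q (npair i s)) l] extends [l] by an inference of [q] from the
    line number [i] of [l] and the head line of [l]; the witness [s] is a zero
    of the matrix [d] of the rule relation.  A line with conclusion 0 needs no
    justification, so the tail 0 of every list is harmless.  A defect is 0 if
    the line, respectively every line of the derivation, is correct. *)
Definition conclusion (l : nat) : nat := nfst (nfst l).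
Definition premise (l : nat) : nat :=
  conclusion (iter (nfst (nsnd (nfst l))) nsnd (nsnd l)).
Definition line_defect (d : nat -> nat) (l : nat) : nat :=
  conclusion l *
  d (npair (npair (premise l) (npair (conclusion (nsnd l)) (conclusion l)))
           (nsnd (nsnd (nfst l)))).
Definition derivation_defect (d : nat -> nat) (l : nat) : nat :=
  nat_rect _ 0 (fun m r => r + line_defect d (iter m nsnd l)) l.

Lemma derivation_defectP d l :
  derivation_defect d l = 0 <-> forall i, line_defect d (iter i nsnd l) = 0.
Proof.
have H n : nat_rect _ 0 (fun m r => r + line_defect d (iter m nsnd l)) n = 0 <->
    forall i, i < n -> line_defect d (iter i nsnd l) = 0.
  elim: n => //= n IH; split=> [/eqP|Hi].
    rewrite addn_eq0 => /andP[/eqP/IH Hi /eqP Hn] i.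
    by rewrite ltnS leq_eqVlt => /predU1P[->|/Hi].
  by rewrite Hi // addn0; apply/IH => i lt; apply: Hi; apply: leqW.
rewrite /derivation_defect H; split=> [Hi i|Hi i _ //].
have [/Hi //|le_li] := ltnP i l.
by rewrite -(subnK le_li) iterD iter_nsnd_self iter_nsnd0.
Qed.

Lemma sigma1_generated R :
  sigma1 (fun t => R (nfst t) (nfst (nsnd t)) (nsnd (nsnd t))) ->
  sigma1 (generated R).
Proof.
move=> [d Hd HR].
have R_d a b q : R a b q <-> exists s, d (npair (npair a (npair b q)) s) = 0.
  by have := HR (npair a (npair b q)); rewrite !(nfst_npair, nsnd_npair).
exists (fun z => derivation_defect d (nsnd z)
   + ((conclusion (nsnd z) - nfst z) + (nfst z - conclusion (nsnd z)))).
  have Hline : total_rec (line_defect d).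
    rewrite /line_defect /premise /conclusion.
    apply: total_rec_mul; auto with trec.
    apply: (total_rec_comp Hd (f := fun l => npair (npair
      (nfst (nfst (iter (nfst (nsnd (nfst l))) nsnd (nsnd l))))
      (npair (nfst (nfst (nsnd l))) (nfst (nfst l)))) (nsnd (nsnd (nfst l))))).
    have nsnd_rec := nsnd_total_rec; auto 12 with trec.
  have Hder : total_rec (derivation_defect d).
    apply: (total_rec_ext (f := fun l => nat_rect _ 0 (fun m r =>
        (fun t => nsnd (nsnd t) +
                  line_defect d (iter (nfst (nsnd t)) nsnd (nfst t)))
          (npair l (npair m r))) l)).
      move=> l; rewrite /derivation_defect.
      have eq_rect F G n : (forall m r, F m r = G m r) ->
          nat_rect (fun=> nat) 0 F n = nat_rect _ 0 G n.
        by move=> FG; elim: n => //= n ->.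
      by apply: eq_rect => m r; rewrite !(nfst_npair, nsnd_npair).
    apply: (total_rec_rec (g := fun=> 0) (n := id) (h := fun t =>
      nsnd (nsnd t) + line_defect d (iter (nfst (nsnd t)) nsnd (nfst t))));
      auto with trec.
    have nsnd_rec := nsnd_total_rec; auto 12 with trec.
  rewrite /conclusion; auto 12 with trec.
move=> q; split=> [gen_q|[l]].
  (* To use two derivations of premises in one list, the second is built on
     top of the first. *)
  suff H l : derivation_defect d l = 0 -> exists l',
      [/\ derivation_defect d l' = 0, conclusion l' = q
        & exists i, iter i nsnd l' = l].
    have [l [Hl ql _]] := H 0 erefl.
    by exists l; rewrite !(nfst_npair, nsnd_npair) Hl ql; lia.
  have cons m l' : line_defect d (npair m l') = 0 ->
      derivation_defect d l' = 0 -> derivation_defect d (npair m l') = 0.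
    rewrite !derivation_defectP => Hm Hl' [//|i].
    by rewrite iterS_nsnd.
  elim: gen_q l => {q} [|a b q _ IHa _ IHb Hab] l Hl.
    exists (npair 0 l); split; last by exists 1; rewrite /= nsnd_npair.
      by apply: cons => //; rewrite /line_defect /conclusion nfst_npair mul0n.
    by rewrite /conclusion nfst_npair.
  have [l1 [Hl1 al1 [i1 e1]]] := IHa _ Hl.
  have [l2 [Hl2 bl2 [i2 e2]]] := IHb _ Hl1.
  have /R_d[s Hs] := Hab.
  exists (npair (npair q (npair i2 s)) l2); split.
  - apply: cons => //; rewrite /line_defect /premise /conclusion.
    rewrite !(nfst_npair, nsnd_npair) e2 -!/(conclusion _) al1 bl2.
    by rewrite Hs muln0.
  - by rewrite /conclusion !nfst_npair.
  by exists (i1 + i2).+1; rewrite iterS_nsnd iterD e2.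
rewrite !(nfst_npair, nsnd_npair) => H.
have [Hl ->] : derivation_defect d l = 0 /\ q = conclusion l by lia.
move: Hl; rewrite derivation_defectP => Hl {H q}.
have [n] := ubnP l; elim: n l Hl => // n IH l Hl lt_ln.
have [->|l_gt0] := posnP (conclusion l); first exact: generated0.
have lt_l : nsnd l < l.
  by apply: ltn_nsnd; rewrite lt0n; apply: contraTneq l_gt0 => ->.
have gen_tail j : generated R (conclusion (iter j nsnd (nsnd l))).
  apply: IH => [i|]; first by rewrite -iterD -iterSr.
  elim: j => [|j IHj] /=; first lia.
  exact: leq_ltn_trans (leq_nsnd _) IHj.
apply: (generated_rule (a := premise l) (b := conclusion (nsnd l))).
- exact: gen_tail.
- exact: (gen_tail 0).
apply/R_d; exists (nsnd (nsnd (nfst l))).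
by have /eqP := Hl 0; rewrite muln_eq0 => /orP[|/eqP//]; rewrite eqn0Ngt l_gt0.
Qed.

(** The rule scheme with premises [p w] and [p' w] and conclusion [r w], for
    all [w]. *)
Definition rule (p p' r : nat -> nat) (a b q : nat) : Prop :=
  exists w, [/\ a = p w, b = p' w & q = r w].

(** Semidecidability of a rule relation. *)
Definition sigma1_rules (R : nat -> nat -> nat -> Prop) : Prop :=
  sigma1 (fun t => R (nfst t) (nfst (nsnd t)) (nsnd (nsnd t))).

Lemma sigma1_rule p p' r : total_rec p -> total_rec p' -> total_rec r ->
  sigma1_rules (rule p p' r).
Proof.
move=> Hp Hp' Hr.
pose P t w := nfst t = p w /\ (nfst (nsnd t) = p' w /\ nsnd (nsnd t) = r w).
apply: (sigma1_iff (S := fun t => exists w, P t w)).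
  move=> t; split=> -[w]; first by case=> ? []; exists w.
  by case=> *; exists w; split.
apply: sigma1_ex; rewrite /P.
by do ?apply: sigma1_and; apply: sigma1_eq; auto 7 with trec.
Qed.

Lemma sigma1_rules_or R R' : sigma1_rules R -> sigma1_rules R' ->
  sigma1_rules (fun a b q => R a b q \/ R' a b q).
Proof. exact: sigma1_or. Qed.

(** * The universal function *)

(** The judgement that code number [e] maps [x] to [y], and the judgement that
    code number [a] has a positive value at [npair x m] for all [m < n].  The
    latter splits the rule for minimization, which has unboundedly many
    premises, into rules with two premises. *)
Definition maps (e x y : nat) : nat := (2 * npair (npair e x) y).+1.
Definition positive (a x n : nat) : nat := (2 * npair (npair a x) n).+2.

Lemma maps_inj e x y e' x' y' :
  maps e x y = maps e' x' y' -> [/\ e = e', x = x' & y = y'].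
Proof.
move=> E; have /npair_inj[/npair_inj[-> ->] ->] //:
  npair (npair e x) y = npair (npair e' x') y' by rewrite /maps in E; lia.
Qed.

Lemma positive_inj e x y e' x' y' :
  positive e x y = positive e' x' y' -> [/\ e = e', x = x' & y = y'].
Proof.
move=> E; have /npair_inj[/npair_inj[-> ->] ->] //:
  npair (npair e x) y = npair (npair e' x') y' by rewrite /positive in E; lia.
Qed.

Lemma maps_positive e x y e' x' y' : maps e x y <> positive e' x' y'.
Proof. by rewrite /maps /positive; lia. Qed.

Lemma total_rec_maps f g h : total_rec f -> total_rec g -> total_rec h ->
  total_rec (fun z => maps (f z) (g z) (h z)).
Proof. by rewrite /maps; auto 8 with trec. Qed.

Lemma total_rec_positive f g h : total_rec f -> total_rec g -> total_rec h ->
  total_rec (fun z => positive (f z) (g z) (h z)).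
Proof. by rewrite /positive; auto 8 with trec. Qed.

#[local] Hint Resolve total_rec_maps total_rec_positive : trec.

#[local] Notation "w .[ i ]" := (field i w).

(** The clauses of [eval], and the two clauses of [positive].  Rules with fewer
    than two premises are filled up with the judgement 0, which always holds. *)
Definition eval_rules (a b q : nat) : Prop :=
  rule (fun=> 0) (fun=> 0) (fun w => maps 0 w 0) a b q
  \/ rule (fun=> 0) (fun=> 0) (fun w => maps 1 w w.+1) a b q
  \/ rule (fun=> 0) (fun=> 0) (fun w => maps 2 w (nfst w)) a b q
  \/ rule (fun=> 0) (fun=> 0) (fun w => maps 3 w (nsnd w)) a b q
  \/ rule (fun w => maps w.[0] w.[2] w.[3]) (fun w => maps w.[1] w.[2] w.[4])
       (fun w => maps (4 + 4 * npair w.[0] w.[1]) w.[2] (npair w.[3] w.[4]))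
       a b q
  \/ rule (fun w => maps w.[1] w.[2] w.[3]) (fun w => maps w.[0] w.[3] w.[4])
       (fun w => maps (5 + 4 * npair w.[0] w.[1]) w.[2] w.[4]) a b q
  \/ rule (fun w => maps w.[0] w.[2] w.[3]) (fun=> 0)
       (fun w => maps (6 + 4 * npair w.[0] w.[1]) (npair w.[2] 0) w.[3]) a b q
  \/ rule (fun w => maps (6 + 4 * npair w.[0] w.[1]) (npair w.[2] w.[3]) w.[4])
       (fun w => maps w.[1] (npair w.[2] (npair w.[3] w.[4])) w.[5])
       (fun w => maps (6 + 4 * npair w.[0] w.[1]) (npair w.[2] w.[3].+1) w.[5])
       a b q
  \/ rule (fun=> 0) (fun=> 0) (fun w => positive w.[0] w.[1] 0) a b q
  \/ rule (fun w => positive w.[0] w.[1] w.[2])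
       (fun w => maps w.[0] (npair w.[1] w.[2]) w.[3].+1)
       (fun w => positive w.[0] w.[1] w.[2].+1) a b q
  \/ rule (fun w => positive w.[0] w.[1] w.[2])
       (fun w => maps w.[0] (npair w.[1] w.[2]) 0)
       (fun w => maps (7 + 4 * w.[0]) w.[1] w.[2]) a b q.

Lemma sigma1_eval_rules : sigma1_rules eval_rules.
Proof.
by do ?apply: sigma1_rules_or; apply: sigma1_rule; auto 12 with trec.
Qed.

Lemma generated_eval c x y :
  eval c x y -> generated eval_rules (maps (encode c) x y).
Proof.
have zero := generated0 eval_rules.
elim=> {c x y}.
- by move=> x; apply: (generated_rule zero zero); left; exists x.
- by move=> x; apply: (generated_rule zero zero); right; left; exists x.
- by move=> x; apply: (generated_rule zero zero); do 2 right; left; exists x.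
- by move=> x; apply: (generated_rule zero zero); do 3 right; left; exists x.
- move=> a b x y z _ IHa _ IHb; apply: (generated_rule IHa IHb).
  do 4 right; left; exists (pack [:: encode a; encode b; x; y; z]).
  by rewrite /= !fieldE.
- move=> a b x y z _ IHb _ IHa; apply: (generated_rule IHb IHa).
  do 5 right; left; exists (pack [:: encode a; encode b; x; y; z]).
  by rewrite /= !fieldE.
- move=> a b x y _ IHa; apply: (generated_rule IHa zero).
  do 6 right; left; exists (pack [:: encode a; encode b; x; y]).
  by rewrite /= !fieldE.
- move=> a b x n y z _ IHa _ IHb; apply: (generated_rule IHa IHb).
  do 7 right; left; exists (pack [:: encode a; encode b; x; n; y; z]).
  by rewrite /= !fieldE.
move=> a x n k _ IHk _ IHn.
have pos m : m <= n -> generated eval_rules (positive (encode a) x m).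
  elim: m => [_|m IH lt_mn].
    apply: (generated_rule zero zero); do 8 right; left.
    by exists (pack [:: encode a; x]); rewrite /= !fieldE.
  apply: (generated_rule (IH (ltnW lt_mn)) (IHk _ lt_mn)); do 9 right; left.
  by exists (pack [:: encode a; x; m; k m]); rewrite /= !fieldE.
apply: (generated_rule (pos n (leqnn n)) IHn); do 10 right.
by exists (pack [:: encode a; x; n]); rewrite /= !fieldE.
Qed.

Lemma generated_phi e x y : generated eval_rules (maps e x y) -> phi e x y.
Proof.
suff H j : generated eval_rules j ->
    (forall e x y, j = maps e x y -> phi e x y) /\
    (forall a x n, j = positive a x n ->
      exists k, forall m, m < n -> phi a (npair x m) (k m).+1).
  by move=> /H[H1 _]; exact: H1.
elim=> {e x y j} [|p p' q _ [IH IHp] _ [IH' _]]; first by split.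
pose sem j := (forall e x y, j = maps e x y -> phi e x y) /\
    (forall a x n, j = positive a x n ->
      exists k, forall m, m < n -> phi a (npair x m) (k m).+1).
have sem_maps e x y : phi e x y -> sem (maps e x y).
  by move=> H; split=> [? ? ? /maps_inj[<- <- <-]|? ? ? /maps_positive].
have sem_pos a x n k : (forall m, m < n -> phi a (npair x m) (k m).+1) ->
    sem (positive a x n).
  move=> H; split=> ? ? ?; first by move/esym/maps_positive.
  move=> /positive_inj[<- <- <-].
  by exists k.
rewrite -/(sem q); case=> [[w [_ _ ->]]|].
  by apply: sem_maps; exists CZero => //; constructor.
case=> [[w [_ _ ->]]|].
  by apply: sem_maps; exists CSucc => //; constructor.
case=> [[w [_ _ ->]]|].
  by apply: sem_maps; exists CFst => //; constructor.
case=> [[w [_ _ ->]]|].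
  by apply: sem_maps; exists CSnd => //; constructor.
case=> [[w [/IH[a Ha ea] /IH'[b Hb eb] ->]]|].
  by apply: sem_maps; exists (CPair a b); rewrite /= ?Ha ?Hb //; constructor.
case=> [[w [/IH[b Hb eb] /IH'[a Ha ea] ->]]|].
  apply: sem_maps; exists (CComp a b); rewrite /= ?Ha ?Hb //.
  exact: eval_comp eb ea.
case=> [[w [/IH[a Ha ea] _ ->]]|].
  have [b Hb] := encode_surj w.[1].
  by apply: sem_maps; exists (CPrec a b); rewrite /= ?Ha ?Hb //; constructor.
case=> [[w [/IH[c Hc ec] /IH'[b' Hb' eb'] ->]]|].
  have [a Ha] := encode_surj w.[0]; have [b Hb] := encode_surj w.[1].
  have ? : c = CPrec a b by apply: encode_inj; rewrite Hc /= Ha Hb.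
  have ? : b' = b by apply: encode_inj; rewrite Hb'.
  subst; apply: sem_maps; exists (CPrec a b); rewrite /= ?Ha ?Hb //.
  exact: eval_precS ec eb'.
case=> [[w [_ _ ->]]|]; first exact: (sem_pos _ _ _ id).
case=> [[w [/IHp[k Hk] /IH' Hn ->]]|].
  apply: (sem_pos _ _ _ (fun m => if m == w.[2] then w.[3] else k m)) => m.
  by case: eqP => [->//|] ? ?; apply: Hk; lia.
case=> w [/IHp[k Hk] /IH'[a Ha ea] ->].
apply: sem_maps; exists (CMu a); first by rewrite /= Ha.
apply: (@eval_mu _ _ _ k) => // m /Hk[a' Ha'].
by have -> : a' = a by apply: encode_inj; rewrite Ha'.
Qed.

(** The graph of the universal function is semidecidable. *)
Theorem sigma1_phi :
  sigma1 (fun t => phi (nfst t) (nfst (nsnd t)) (nsnd (nsnd t))).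
Proof.
apply: (sigma1_iff (S := fun t =>
    generated eval_rules (maps (nfst t) (nfst (nsnd t)) (nsnd (nsnd t))))).
  move=> t; split; first exact: generated_phi.
  by move=> [c <- /generated_eval].
have H := sigma1_generated sigma1_eval_rules.
by apply: (sigma1_comp H); auto with trec.
Qed.

Lemma sigma1_phi_comp f g h : total_rec f -> total_rec g -> total_rec h ->
  sigma1 (fun z => phi (f z) (g z) (h z)).
Proof.
move=> Hf Hg Hh.
apply: (sigma1_iff _ (sigma1_comp (f := fun z => npair (f z) (npair (g z) (h z)))
  sigma1_phi _)); last by auto with trec.
by move=> z; rewrite !(nfst_npair, nsnd_npair).
Qed.

Lemma sigma1_W_comp f g : total_rec f -> total_rec g ->
  sigma1 (fun z => W (f z) (g z)).
Proof.
move=> Hf Hg; apply: sigma1_ex; apply: sigma1_phi_comp; auto with trec.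
Qed.

(** * Effective inseparability from a diagonal function *)

(** A pair of disjoint sets is effectively inseparable if a total computable
    function [f] sends every computation with value 0 into [A] and every
    computation with value 1 into [B]. *)
Lemma effectively_inseparable_diag (A B : nat -> Prop) f :
  (forall x, A x -> B x -> False) -> computable2 f ->
  (forall e x, phi e x 0 -> A (f e x)) ->
  (forall e x, phi e x 1 -> B (f e x)) ->
  effectively_inseparable A B.
Proof.
move=> AB [cf Hf] fA fB; split=> //.
have Ff : total_rec (fun z => f (nfst z) (nsnd z)).
  have [c Hc] := encode_surj cf; exists c => z.
  have [c' ec Hc'] := Hf (nfst z) (nsnd z); rewrite npair_surj in Hc'.
  by have -> : c = c' by apply: encode_inj; rewrite Hc ec.
(* The program [c] gets its own index [e] as the first component of its input
   [z], and so can refer to the number [f e z] that its answer is about. *)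
pose N z := f (nfst z) z.
have N_rec : total_rec N.
  apply: (total_rec_ext (f := fun z => (fun t => f (nfst t) (nsnd t))
    (npair (nfst z) z))); first by move=> z; rewrite nfst_npair nsnd_npair.
  by apply: (total_rec_comp Ff); auto with trec.
have [|du du_rec Hdu] := @sigma1_W_comp (fun z => nfst (nsnd z)) N _ N_rec.
  by auto with trec.
have [|dv dv_rec Hdv] := @sigma1_W_comp (fun z => nsnd (nsnd z)) N _ N_rec.
  by auto with trec.
have [cs Hcs] := total_rec_mul du_rec dv_rec.
(* At the first zero of [du * dv], the answer is 1 if [du] vanishes, that is, if
   [N z] is in [W u], and is 0 otherwise. *)
have [co Hco] : total_rec (fun t => 1 - du t) by auto with trec.
have [ci Hci] := total_rec_id.
pose c := CComp co (CPair ci (CMu cs)); pose e := encode c.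
have [p Hp] : total_rec (fun t => N (npair e t)) by auto with trec.
exists (encode p) => u v Au Bv UV.
pose z := npair e (npair u v).
have eu n : W u n <-> W (nfst (nsnd z)) n by rewrite !(nfst_npair, nsnd_npair).
have ev n : W v n <-> W (nsnd (nsnd z)) n by rewrite !(nfst_npair, nsnd_npair).
have Nz : N z = f e z by rewrite /N nfst_npair.
have phi_c s : du (npair z s) * dv (npair z s) = 0 ->
    exists2 n, du (npair z n) * dv (npair z n) = 0
             & phi e z (1 - du (npair z n)).
  move=> /(eval_search Hcs)[n Hn zero_n]; exists n => //; exists c => //.
  apply: (eval_comp (y := npair z n)); last exact: Hco.
  by constructor.
exists (N z); first by exists p.
split=> [Wu|Wv].
  have noWv s : dv (npair z s) != 0.
    apply/eqP => ds; apply: (UV (N z)) => //.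
    by apply/ev/Hdv; exists s.
  have /eu/Hdu[s ds] := Wu.
  have [|n] := phi_c s; first by rewrite ds.
  move=> /eqP; rewrite muln_eq0 (negPf (noWv n)) orbF => /eqP -> /fB.
  by rewrite -Nz => /Bv; exact: UV.
have noWu s : du (npair z s) != 0.
  apply/eqP => ds; apply: (UV (N z)) => //.
  by apply/eu/Hdu; exists s.
have /ev/Hdv[s ds] := Wv.
have [|n _] := phi_c s; first by rewrite ds muln0.
have -> : 1 - du (npair z n) = 0 by have := noWu n; lia.
by move=> /fA; rewrite -Nz => /Au Wu; exact: UV Wu Wv.
Qed.

(** The function [f] of a precomplete pre-lattice is a diagonal function. *)
Lemma precomplete_ei_bounds L :
  ce_bounded_prelattice L -> precomplete L -> ei_bounds L.
Proof.
move=> [HL bnd] [[x [y xy]] [f Hf f_phi]].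
have trans := lle_trans HL.
apply: (effectively_inseparable_diag (f := f)) => //.
- move=> z [z1 z2] [z3 z4]; apply: xy.
  have top_bot : lle L 1 0 by apply: (trans _ _ _ z3 z2).
  have le t t' : lle L t t'.
    apply: (trans _ _ _ (proj2 (bnd t))).
    exact: (trans _ _ _ top_bot (proj1 (bnd t'))).
  by split; apply: le.
- by move=> e z /f_phi[].
- by move=> e z /f_phi[].
Qed.

Lemma ei_heyting_distributive (H : heyting_sig) :
  ei_heyting H -> ei_distributive H.
Proof.
move=> [[bH _ _ adj] ei]; split=> // x y z.
have [HL _] := bH; have trans := lle_trans HL; have refl := lle_refl HL.
have glb := lmeet_glb HL; have lub := ljoin_lub HL.
have meetl a b : lle H (lmeet H a b) a by have /glb[] := refl (lmeet H a b).
have meetr a b : lle H (lmeet H a b) b by have /glb[] := refl (lmeet H a b).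
have joinl a b : lle H a (ljoin H a b) by have /lub[] := refl (ljoin H a b).
have joinr a b : lle H b (ljoin H a b) by have /lub[] := refl (ljoin H a b).
have comm a b : lle H (lmeet H a b) (lmeet H b a) by apply/glb.
split.
  apply: (trans _ _ _ (comm _ _)); apply/adj/lub; split; apply/adj.
    exact: (trans _ _ _ (comm _ _) (joinl _ _)).
  exact: (trans _ _ _ (comm _ _) (joinr _ _)).
apply/lub; split; apply/glb; split=> //.
  exact: (trans _ _ _ (meetr _ _) (joinl _ _)).
exact: (trans _ _ _ (meetr _ _) (joinr _ _)).
Qed.

(** * Presented pre-lattices *)

(** Every number is a term: 0 and 1 are the bounds, and the other numbers are
    meets, joins, generators [tgen e k] (one for each computation of the
    [e]-th partial computable function at [k]), and implications.  Where no
    law mentions implication, the terms [timp a b] are merely further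
    generators. *)
Definition tmeet (x y : nat) : nat := 2 + 3 * npair x y.
Definition tjoin (x y : nat) : nat := 3 + 3 * npair x y.
Definition tgen (e k : nat) : nat := 4 + 3 * (2 * npair e k).
Definition timp (x y : nat) : nat := 4 + 3 * (2 * npair x y).+1.

Lemma tmeet_inj x y x' y' : tmeet x y = tmeet x' y' -> x = x' /\ y = y'.
Proof. by rewrite /tmeet => E; apply: npair_inj; lia. Qed.

Lemma tjoin_inj x y x' y' : tjoin x y = tjoin x' y' -> x = x' /\ y = y'.
Proof. by rewrite /tjoin => E; apply: npair_inj; lia. Qed.

Lemma tgen_inj x y x' y' : tgen x y = tgen x' y' -> x = x' /\ y = y'.
Proof. by rewrite /tgen => E; apply: npair_inj; lia. Qed.

Lemma timp_inj x y x' y' : timp x y = timp x' y' -> x = x' /\ y = y'.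
Proof. by rewrite /timp => E; apply: npair_inj; lia. Qed.

Lemma term_disjoint x y x' y' :
  [/\ tmeet x y <> tjoin x' y', tmeet x y <> tgen x' y',
       tmeet x y <> timp x' y', tjoin x y <> tgen x' y'
     & tjoin x y <> timp x' y' /\ tgen x y <> timp x' y'].
Proof. by rewrite /tmeet /tjoin /tgen /timp; do !split; lia. Qed.

Lemma leq_timp x y : x <= timp x y.
Proof. by have := leq_npair x y; rewrite /timp; lia. Qed.

Lemma term_ind (P : nat -> Prop) :
  P 0 -> P 1 -> (forall x y, P x -> P y -> P (tmeet x y)) ->
  (forall x y, P x -> P y -> P (tjoin x y)) -> (forall e k, P (tgen e k)) ->
  (forall x y, P x -> P y -> P (timp x y)) -> forall x, P x.
Proof.
move=> P0 P1 Pm Pj Pg Pi x.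
have [n] := ubnP x; elim: n x => // n IH [|[|x]] lt_xn //.
have xE := divn_eq x 3; move: (x %/ 3) (x %% 3) xE (ltn_pmod x (isT : 0 < 3)).
move=> q r xE.
have binary z : z < x.+2 -> P (nfst z) /\ P (nsnd z).
  by move=> lt; split; apply: IH; have := leq_nfst z; have := leq_nsnd z; lia.
case: r xE => [|[|[|//]]] xE _.
- have [] := binary q; first by lia.
  by move=> /Pm H /H; rewrite /tmeet npair_surj; congr P; lia.
- have [] := binary q; first by lia.
  by move=> /Pj H /H; rewrite /tjoin npair_surj; congr P; lia.
have [] := binary q./2; first by lia.
have [odd_q|even_q] := boolP (odd q).
  by move=> /Pi H /H; rewrite /timp npair_surj; congr P; lia.
move=> _ _; have := Pg (nfst q./2) (nsnd q./2).
by rewrite /tgen npair_surj; congr P; lia.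
Qed.

(** The least pre-order on terms that satisfies the laws of bounded lattices
    and the inequalities [Ax], and, if [hey] holds, for which [timp] is
    relative pseudo-complementation. *)
Inductive der (hey : bool) (Ax : nat -> nat -> Prop) : nat -> nat -> Prop :=
| der_refl x : der hey Ax x x
| der_bot x : der hey Ax 0 x
| der_top x : der hey Ax x 1
| der_meetl x y : der hey Ax (tmeet x y) x
| der_meetr x y : der hey Ax (tmeet x y) y
| der_joinl x y : der hey Ax x (tjoin x y)
| der_joinr x y : der hey Ax y (tjoin x y)
| der_impE x y : hey -> der hey Ax (tmeet (timp x y) x) y
| der_ax x y : Ax x y -> der hey Ax x y
| der_trans x y z : der hey Ax x y -> der hey Ax y z -> der hey Ax x z
| der_glb x y z : der hey Ax z x -> der hey Ax z y -> der hey Ax z (tmeet x y)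
| der_lub x y z : der hey Ax x z -> der hey Ax y z -> der hey Ax (tjoin x y) z
| der_impI x y z : hey -> der hey Ax (tmeet z x) y -> der hey Ax z (timp x y).

(** The pre-lattice of terms with the order [der hey Ax]. *)
Definition presented (hey : bool) (Ax : nat -> nat -> Prop) : lat_sig :=
  LatSig tmeet tjoin (der hey Ax).

(** Semidecidability of a binary relation. *)
Definition sigma1_rel (Ax : nat -> nat -> Prop) : Prop :=
  sigma1 (fun z => Ax (nfst z) (nsnd z)).

Lemma total_rec_tmeet f g : total_rec f -> total_rec g ->
  total_rec (fun z => tmeet (f z) (g z)).
Proof. by rewrite /tmeet; auto 8 with trec. Qed.

Lemma total_rec_tjoin f g : total_rec f -> total_rec g ->
  total_rec (fun z => tjoin (f z) (g z)).
Proof. by rewrite /tjoin; auto 8 with trec. Qed.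

Lemma total_rec_tgen f g : total_rec f -> total_rec g ->
  total_rec (fun z => tgen (f z) (g z)).
Proof. by rewrite /tgen; auto 10 with trec. Qed.

Lemma total_rec_timp f g : total_rec f -> total_rec g ->
  total_rec (fun z => timp (f z) (g z)).
Proof. by rewrite /timp; auto 10 with trec. Qed.

#[local] Hint Resolve total_rec_tmeet total_rec_tjoin total_rec_tgen
  total_rec_timp : trec.

(** The clauses of [der], in the order of its constructors, for the judgements
    [npair x y]; the trivial judgement 0 is [npair 0 0], a case of
    reflexivity. *)
Definition der_rules (hey : bool) (Ax : nat -> nat -> Prop) (a b q : nat) :
    Prop :=
  rule (fun=> 0) (fun=> 0) (fun w => npair w w) a b q
  \/ rule (fun=> 0) (fun=> 0) (fun w => npair 0 w) a b q
  \/ rule (fun=> 0) (fun=> 0) (fun w => npair w 1) a b q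
  \/ rule (fun=> 0) (fun=> 0) (fun w => npair (tmeet w.[0] w.[1]) w.[0]) a b q
  \/ rule (fun=> 0) (fun=> 0) (fun w => npair (tmeet w.[0] w.[1]) w.[1]) a b q
  \/ rule (fun=> 0) (fun=> 0) (fun w => npair w.[0] (tjoin w.[0] w.[1])) a b q
  \/ rule (fun=> 0) (fun=> 0) (fun w => npair w.[1] (tjoin w.[0] w.[1])) a b q
  \/ (hey /\ rule (fun=> 0) (fun=> 0)
       (fun w => npair (tmeet (timp w.[0] w.[1]) w.[0]) w.[1]) a b q)
  \/ Ax (nfst q) (nsnd q)
  \/ rule (fun w => npair w.[0] w.[1]) (fun w => npair w.[1] w.[2])
       (fun w => npair w.[0] w.[2]) a b q
  \/ rule (fun w => npair w.[2] w.[0]) (fun w => npair w.[2] w.[1])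
       (fun w => npair w.[2] (tmeet w.[0] w.[1])) a b q
  \/ rule (fun w => npair w.[0] w.[2]) (fun w => npair w.[1] w.[2])
       (fun w => npair (tjoin w.[0] w.[1]) w.[2]) a b q
  \/ (hey /\ rule (fun w => npair (tmeet w.[2] w.[0]) w.[1]) (fun=> 0)
       (fun w => npair w.[2] (timp w.[0] w.[1])) a b q).

Lemma generated_der hey Ax x y :
  der hey Ax x y -> generated (der_rules hey Ax) (npair x y).
Proof.
have zero := generated0 (der_rules hey Ax).
elim=> {x y}.
- by move=> x; apply: (generated_rule zero zero); left; exists x.
- by move=> x; apply: (generated_rule zero zero); right; left; exists x.
- by move=> x; apply: (generated_rule zero zero); do 2 right; left; exists x.
- move=> x y; apply: (generated_rule zero zero); do 3 right; left.
  by exists (pack [:: x; y]); rewrite /= !fieldE.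
- move=> x y; apply: (generated_rule zero zero); do 4 right; left.
  by exists (pack [:: x; y]); rewrite /= !fieldE.
- move=> x y; apply: (generated_rule zero zero); do 5 right; left.
  by exists (pack [:: x; y]); rewrite /= !fieldE.
- move=> x y; apply: (generated_rule zero zero); do 6 right; left.
  by exists (pack [:: x; y]); rewrite /= !fieldE.
- move=> x y h; apply: (generated_rule zero zero); do 7 right; left; split=> //.
  by exists (pack [:: x; y]); rewrite /= !fieldE.
- move=> x y h; apply: (generated_rule zero zero); do 8 right; left.
  by rewrite nfst_npair nsnd_npair.
- move=> x y z _ IH _ IH'; apply: (generated_rule IH IH'); do 9 right; left.
  by exists (pack [:: x; y; z]); rewrite /= !fieldE.
- move=> x y z _ IH _ IH'; apply: (generated_rule IH IH'); do 10 right; left.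
  by exists (pack [:: x; y; z]); rewrite /= !fieldE.
- move=> x y z _ IH _ IH'; apply: (generated_rule IH IH'); do 11 right; left.
  by exists (pack [:: x; y; z]); rewrite /= !fieldE.
move=> x y z h _ IH; apply: (generated_rule IH zero); do 12 right; split=> //.
by exists (pack [:: x; y; z]); rewrite /= !fieldE.
Qed.

Lemma der_generated hey Ax x y :
  generated (der_rules hey Ax) (npair x y) -> der hey Ax x y.
Proof.
suff H t : generated (der_rules hey Ax) t -> der hey Ax (nfst t) (nsnd t).
  by move=> /H; rewrite nfst_npair nsnd_npair.
elim=> {x y t} [|p p' q _ IH _ IH'] /=; first exact: der_refl.
do ![case=> [[w [ep ep' ->]]|]
  | case=> [[h [w [ep ep' ->]]]|] | case=> [Axq|]]; last 1 first.
  case=> h [w [ep ep' ->]].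
all: rewrite ?ep ?ep' ?(nfst_npair, nsnd_npair) in IH IH' *.
all: by [constructor | exact: der_ax | exact: der_impE | exact: der_impI
  | exact: (der_trans IH IH')].
Qed.

Lemma sigma1_der hey Ax : sigma1_rel Ax -> sigma1_rel (der hey Ax).
Proof.
move=> HAx.
apply: (sigma1_iff (S := generated (der_rules hey Ax))).
  move=> t; rewrite -{1}(npair_surj t).
  by split; [exact: der_generated | exact: generated_der].
apply: sigma1_generated; rewrite -/(sigma1_rules _) /der_rules.
do !apply: sigma1_rules_or; try by apply: sigma1_rule; auto 12 with trec.
- apply: sigma1_and; first exact: sigma1_const.
  by apply: sigma1_rule; auto 12 with trec.
- by apply: (sigma1_comp HAx); auto with trec.
- apply: sigma1_and; first exact: sigma1_const.
  by apply: sigma1_rule; auto 12 with trec.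
Qed.

Lemma presented_bounded hey Ax :
  sigma1_rel Ax -> ~ der hey Ax 1 0 -> ce_bounded_prelattice (presented hey Ax).
Proof.
move=> HAx ntriv; split; last by move=> x; split; constructor.
have trans x y z := @der_trans hey Ax x y z.
split=> //=.
- by apply: computable2P; auto with trec.
- by apply: computable2P; auto with trec.
- have [e He] := sigma1_W (@sigma1_der hey _ HAx).
  by exists e => x y; rewrite -He nfst_npair nsnd_npair.
- exact: der_refl.
- move=> x x' y y' [xx' x'x] [yy' y'y]; split; apply: der_glb.
  + exact: (trans _ _ _ (der_meetl _ _ _ _) xx').
  + exact: (trans _ _ _ (der_meetr _ _ _ _) yy').
  + exact: (trans _ _ _ (der_meetl _ _ _ _) x'x).
  + exact: (trans _ _ _ (der_meetr _ _ _ _) y'y).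
- move=> x x' y y' [xx' x'x] [yy' y'y]; split; apply: der_lub.
  + exact: (trans _ _ _ xx' (der_joinl _ _ _ _)).
  + exact: (trans _ _ _ yy' (der_joinr _ _ _ _)).
  + exact: (trans _ _ _ x'x (der_joinl _ _ _ _)).
  + exact: (trans _ _ _ y'y (der_joinr _ _ _ _)).
- move=> x y z; split=> [h|[? ?]]; last exact: der_glb.
  by split; apply: (trans _ _ _ h); constructor.
- move=> x y z; split=> [h|[? ?]]; last exact: der_lub.
  by split; apply: (trans _ _ _ _ h); constructor.
by exists 0, 1 => -[].
Qed.

(** If the laws identify [tgen e k] with the value of the computation that it
    stands for, whenever that value is 0 or 1, then the bounds are effectively
    inseparable. *)
Lemma presented_ei hey Ax : sigma1_rel Ax -> ~ der hey Ax 1 0 ->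
  (forall e k y, phi e k y -> y < 2 -> Ax (tgen e k) y /\ Ax y (tgen e k)) ->
  ei_prelattice (presented hey Ax).
Proof.
move=> HAx ntriv gen; split; first exact: presented_bounded.
apply: (effectively_inseparable_diag (f := tgen)).
- by move=> x [x0 x1] [x2 x3]; apply: ntriv; exact: (der_trans x2 x1).
- by apply: computable2P; auto with trec.
- by move=> e x /gen[] // ? ?; split; apply: der_ax.
by move=> e x /gen[] // ? ?; split; apply: der_ax.
Qed.

(** A map [F] from terms into a pre-order satisfies the laws of bounded
    lattices. *)
Record interprets (T : Type) (le : T -> T -> Prop) (F : nat -> T) : Prop := {
  int_refl x : le (F x) (F x);
  int_trans x y z : le (F x) (F y) -> le (F y) (F z) -> le (F x) (F z);
  int_bot x : le (F 0) (F x);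
  int_top x : le (F x) (F 1);
  int_meet x y z :
    le (F z) (F (tmeet x y)) <-> le (F z) (F x) /\ le (F z) (F y);
  int_join x y z :
    le (F (tjoin x y)) (F z) <-> le (F x) (F z) /\ le (F y) (F z) }.

Lemma der_sound (hey : bool) Ax T le (F : nat -> T) : interprets le F ->
  (hey -> forall x y z,
     le (F z) (F (timp x y)) <-> le (F (tmeet z x)) (F y)) ->
  (forall x y, Ax x y -> le (F x) (F y)) ->
  forall x y, der hey Ax x y -> le (F x) (F y).
Proof.
move=> [refl trans bot top meet join] imp ax x y; elim=> {x y} //.
- by move=> x y; have /meet[] := refl (tmeet x y).
- by move=> x y; have /meet[] := refl (tmeet x y).
- by move=> x y; have /join[] := refl (tjoin x y).
- by move=> x y; have /join[] := refl (tjoin x y).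
- by move=> x y h; apply/imp.
- by move=> x y z _ xy _ yz; exact: (trans _ _ _ xy yz).
- by move=> x y z _ zx _ zy; apply/meet.
- by move=> x y z _ zx _ zy; apply/join.
by move=> x y z h _ ?; apply/imp.
Qed.

(** * Evaluation of terms *)

(** Operations on [T] for the term constructors.  The operation for [timp a b]
    is given both the terms [a] and [b] and their values: where implication is
    a connective only the values matter, elsewhere only the terms. *)
Record algebra (T : Type) := Algebra {
  abot : T; atop : T;
  ameet : T -> T -> T; ajoin : T -> T -> T;
  agen : nat -> nat -> T;
  aimp : nat -> nat -> T -> T -> T }.

(** The value of the term [x], if it is smaller than the recursion bound [n]. *)
Fixpoint term_eval_rec (T : Type) (A : algebra T) (n x : nat) : T :=
  if n isn't n'.+1 then abot A else
  match x with
  | 0 => abot A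
  | 1 => atop A
  | x'.+2 =>
    let q := x' %/ 3 in
    match x' %% 3 with
    | 0 => ameet A (term_eval_rec A n' (nfst q)) (term_eval_rec A n' (nsnd q))
    | 1 => ajoin A (term_eval_rec A n' (nfst q)) (term_eval_rec A n' (nsnd q))
    | _ =>
      let r := q./2 in
      if odd q then aimp A (nfst r) (nsnd r) (term_eval_rec A n' (nfst r))
                                             (term_eval_rec A n' (nsnd r))
      else agen A (nfst r) (nsnd r)
    end
  end.

(** The value of the term [x] in [A]. *)
Definition term_eval (T : Type) (A : algebra T) (x : nat) : T :=
  term_eval_rec A x.+1 x.

Lemma term_eval_recE T (A : algebra T) n x : x < n ->
  term_eval_rec A n x = term_eval A x.
Proof.
rewrite /term_eval; have [m] := ubnP x.
elim: m n x => // m IH [|n] [|[|x]] // lt_m lt_n.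
have le_n z : z < x.+2 ->
    term_eval_rec A n (nfst z) = term_eval_rec A x.+2 (nfst z) /\
    term_eval_rec A n (nsnd z) = term_eval_rec A x.+2 (nsnd z).
  move=> lt_z; have := leq_nfst z; have := leq_nsnd z => ? ?.
  by split; rewrite (IH n) ?(IH x.+2) //; lia.
have [q1 q2] : x %/ 3 < x.+2 /\ (x %/ 3)./2 < x.+2.
  by have := leq_div x 3; split; lia.
have [e1 e2] := le_n _ q1; have [e3 e4] := le_n _ q2.
rewrite [LHS]/= [RHS]/=.
by case: (x %% 3) => [|[|_]]; rewrite ?e1 ?e2 ?e3 ?e4.
Qed.

Lemma term_evalE T (A : algebra T) :
  [/\ term_eval A 0 = abot A, term_eval A 1 = atop A,
      forall x y,
        term_eval A (tmeet x y) = ameet A (term_eval A x) (term_eval A y),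
      forall x y,
        term_eval A (tjoin x y) = ajoin A (term_eval A x) (term_eval A y)
    & (forall e k, term_eval A (tgen e k) = agen A e k) /\
      (forall x y, term_eval A (timp x y) =
         aimp A x y (term_eval A x) (term_eval A y))].
Proof.
have unfold x q r : x %/ 3 = q -> x %% 3 = r -> term_eval A x.+2 =
    match r with
    | 0 => ameet A (term_eval A (nfst q)) (term_eval A (nsnd q))
    | 1 => ajoin A (term_eval A (nfst q)) (term_eval A (nsnd q))
    | _ =>
      if odd q then aimp A (nfst q./2) (nsnd q./2) (term_eval A (nfst q./2))
                                                   (term_eval A (nsnd q./2))
      else agen A (nfst q./2) (nsnd q./2)
    end.
  move=> <- <-.
  have lt z : z <= x -> nfst z < x.+2 /\ nsnd z < x.+2.
    by have := leq_nfst z; have := leq_nsnd z; lia.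
  have [q1 q2] := lt (x %/ 3) (leq_div _ _).
  have [|r1 r2] := lt (x %/ 3)./2; first by have := leq_div x 3; lia.
  by rewrite -(term_eval_recE A q1) -(term_eval_recE A q2)
    -(term_eval_recE A r1) -(term_eval_recE A r2).
split=> //.
- move=> x y; rewrite [tmeet _ _](_ : _ = (0 + 3 * npair x y).+2) //.
  rewrite (unfold _ (npair x y) 0); try lia.
  by rewrite nfst_npair nsnd_npair.
- move=> x y; rewrite [tjoin _ _](_ : _ = (1 + 3 * npair x y).+2) //.
  rewrite (unfold _ (npair x y) 1); try lia.
  by rewrite nfst_npair nsnd_npair.
split=> x y.
  rewrite [tgen _ _](_ : _ = (2 + 3 * (2 * npair x y)).+2) //.
  rewrite (unfold _ (2 * npair x y) 2); try lia.
  have -> : odd (2 * npair x y) = false by lia.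
  have -> : (2 * npair x y)./2 = npair x y by lia.
  by rewrite nfst_npair nsnd_npair.
rewrite [timp _ _](_ : _ = (2 + 3 * (2 * npair x y).+1).+2) //.
rewrite (unfold _ (2 * npair x y).+1 2); try lia.
have -> : odd (2 * npair x y).+1 by lia.
have -> : ((2 * npair x y).+1)./2 = npair x y by lia.
by rewrite nfst_npair nsnd_npair.
Qed.

Lemma term_eval0 T (A : algebra T) : term_eval A 0 = abot A.
Proof. by []. Qed.

Lemma term_eval1 T (A : algebra T) : term_eval A 1 = atop A.
Proof. by []. Qed.

Lemma term_eval_meet T (A : algebra T) x y :
  term_eval A (tmeet x y) = ameet A (term_eval A x) (term_eval A y).
Proof. by have [] := term_evalE A. Qed.

Lemma term_eval_join T (A : algebra T) x y :
  term_eval A (tjoin x y) = ajoin A (term_eval A x) (term_eval A y).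
Proof. by have [] := term_evalE A. Qed.

Lemma term_eval_gen T (A : algebra T) e k :
  term_eval A (tgen e k) = agen A e k.
Proof. by have [_ _ _ _ []] := term_evalE A. Qed.

Lemma term_eval_imp T (A : algebra T) x y :
  term_eval A (timp x y) = aimp A x y (term_eval A x) (term_eval A y).
Proof. by have [_ _ _ _ []] := term_evalE A. Qed.

Definition teE := (term_eval0, term_eval1, term_eval_meet, term_eval_join,
  term_eval_gen, term_eval_imp).

Opaque tmeet tjoin tgen timp.
Arguments term_eval : simpl never.

(** * Laws *)

(** The generator [tgen e k] equals the value of the [e]-th partial computable
    function at [k], if that value is defined and, unless [all] holds, is 0 or
    1. *)
Definition gen_law (all : bool) (x y : nat) : Prop :=
  exists e k i, [/\ all || (i < 2), phi e k i &
    (x = tgen e k /\ y = i) \/ (x = i /\ y = tgen e k)].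

(** Distributivity; the converse inequality holds in every lattice. *)
Definition distr_law (x y : nat) : Prop :=
  exists a b c, x = tmeet a (tjoin b c) /\ y = tjoin (tmeet a b) (tmeet a c).

(** The law of the excluded middle. *)
Definition em_law (x y : nat) : Prop :=
  exists a, x = 1 /\ y = tjoin a (timp a 0).

(** Generators that stand for no computation, where implication is not a
    connective. *)
Definition tconst (i : nat) : nat := timp 0 i.

(** The first two of these generators have meet 0. *)
Definition disjoint_law (x y : nat) : Prop :=
  x = tmeet (tconst 0) (tconst 1) /\ y = 0.

Definition free_laws x y := gen_law false x y \/ distr_law x y.
Definition boolean_laws x y := gen_law false x y \/ em_law x y.
Definition precomplete_laws x y :=
  gen_law true x y \/ distr_law x y \/ disjoint_law x y.

Lemma sigma1_gen_law all : sigma1_rel (gen_law all).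
Proof.
pose P z w := (if all then 0 else w.[2] - 1) = 0 /\ (phi w.[0] w.[1] w.[2] /\
  ((nfst z = tgen w.[0] w.[1] /\ nsnd z = w.[2]) \/
   (nfst z = w.[2] /\ nsnd z = tgen w.[0] w.[1]))).
apply: (sigma1_iff (S := fun z => exists w, P z w)).
  move=> z; split=> [[w [Hi [ph xy]]]|[e [k [i [Hi ph xy]]]]].
    by exists w.[0], w.[1], w.[2]; split=> //; case: (all) Hi => //=; lia.
  exists (pack [:: e; k; i]); rewrite /P /= !fieldE.
  by split=> //; case: (all) Hi => //=; lia.
apply: sigma1_ex; rewrite /P; apply: sigma1_and.
  by apply: sigma1_eq; case: (all); auto 8 with trec.
apply: sigma1_and; first by apply: sigma1_phi_comp; auto with trec.
by apply: sigma1_or; apply: sigma1_and; apply: sigma1_eq; auto 8 with trec.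
Qed.

Lemma sigma1_distr_law : sigma1_rel distr_law.
Proof.
pose P z w := nfst z = tmeet w.[0] (tjoin w.[1] w.[2]) /\
  nsnd z = tjoin (tmeet w.[0] w.[1]) (tmeet w.[0] w.[2]).
apply: (sigma1_iff (S := fun z => exists w, P z w)).
  move=> z; split=> [[w [? ?]]|[a [b [c xy]]]].
    by exists w.[0], w.[1], w.[2].
  by exists (pack [:: a; b; c]); rewrite /P /= !fieldE.
apply: sigma1_ex; rewrite /P.
by apply: sigma1_and; apply: sigma1_eq; auto 8 with trec.
Qed.

Lemma sigma1_em_law : sigma1_rel em_law.
Proof.
pose P z w := nfst z = 1 /\ nsnd z = tjoin w (timp w 0).
apply: (sigma1_iff (S := fun z => exists w, P z w)) => //.
apply: sigma1_ex; rewrite /P.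
by apply: sigma1_and; apply: sigma1_eq; auto 8 with trec.
Qed.

Lemma sigma1_disjoint_law : sigma1_rel disjoint_law.
Proof. by apply: sigma1_and; apply: sigma1_eq; auto 8 with trec. Qed.

Lemma sigma1_free_laws : sigma1_rel free_laws.
Proof. exact: (sigma1_or (sigma1_gen_law _) sigma1_distr_law). Qed.

Lemma sigma1_boolean_laws : sigma1_rel boolean_laws.
Proof. exact: (sigma1_or (sigma1_gen_law _) sigma1_em_law). Qed.

Lemma sigma1_precomplete_laws : sigma1_rel precomplete_laws.
Proof.
apply: (sigma1_or (sigma1_gen_law _)).
exact: (sigma1_or sigma1_distr_law sigma1_disjoint_law).
Qed.

Lemma gen_lawP all e k i : phi e k i -> all || (i < 2) ->
  gen_law all (tgen e k) i /\ gen_law all i (tgen e k).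
Proof. by move=> ph Hi; split; exists e, k, i; split=> //; [left | right]. Qed.

Lemma gen_law_sound T (le : T -> T -> Prop) (F : nat -> T) :
  (forall e k, phi e k 0 ->
     le (F (tgen e k)) (F 0) /\ le (F 0) (F (tgen e k))) ->
  (forall e k, phi e k 1 ->
     le (F (tgen e k)) (F 1) /\ le (F 1) (F (tgen e k))) ->
  forall x y, gen_law false x y -> le (F x) (F y).
Proof.
move=> F0 F1 x y [e [k [[|[|i]] [lt_i2 ph xy]]]] //; move: xy.
  by case: (F0 _ _ ph) => ? ? [[-> ->]|[-> ->]].
by case: (F1 _ _ ph) => ? ? [[-> ->]|[-> ->]].
Qed.

Lemma der_distributive (hey : bool) Ax :
  (forall x y, distr_law x y -> Ax x y) ->
  forall x y z, lequiv (presented hey Ax)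
    (tmeet x (tjoin y z)) (tjoin (tmeet x y) (tmeet x z)).
Proof.
move=> Hd x y z; split; first by apply/der_ax/Hd; exists x, y, z.
apply: der_lub; apply: der_glb; try exact: der_meetl.
  exact: (der_trans (der_meetr _ _ _ _) (der_joinl _ _ _ _)).
exact: (der_trans (der_meetr _ _ _ _) (der_joinr _ _ _ _)).
Qed.

(** * Order invariants *)

(** An isomorphism of the quotient orders, as a relation between
    representatives. *)
Definition order_isomorphic (L M : lat_sig) : Prop :=
  exists S : nat -> nat -> Prop,
    [/\ forall a, exists b, S a b, forall b, exists a, S a b
      & forall a b a' b', S a b -> S a' b' -> (lle L a a' <-> lle M b b')].

(** Membership in the least and in the greatest class. *)
Definition least (L : lat_sig) (z : nat) : Prop := forall t, lle L z t.
Definition greatest (L : lat_sig) (z : nat) : Prop := forall t, lle L t z.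

(** Every element has a complement. *)
Definition complemented (L : lat_sig) : Prop :=
  forall x, exists y,
    (forall z, lle L z x -> lle L z y -> least L z) /\
    (forall z, lle L x z -> lle L y z -> greatest L z).

(** Some meet of two nonzero elements is 0. *)
Definition zero_divisors (L : lat_sig) : Prop :=
  exists x y, [/\ forall z, lle L z x -> lle L z y -> least L z,
    ~ least L x & ~ least L y].

(** Distributivity without reference to the operations: [u] is below the meet
    of [x] with the join of [y] and [z], and [w] is above the join of the meets
    of [x] with [y] and with [z]. *)
Definition order_distributive (L : lat_sig) : Prop :=
  forall x y z u w, lle L u x ->
    (forall t, lle L y t -> lle L z t -> lle L u t) ->
    (forall t, lle L t x -> lle L t y -> lle L t w) ->
    (forall t, lle L t x -> lle L t z -> lle L t w) -> lle L u w.

Lemma order_isomorphic_sym L M : order_isomorphic L M -> order_isomorphic M L.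
Proof.
move=> [S [SL SM Sle]]; exists (fun b a => S a b).
split=> // b a b' a' Sab Sab'.
by split=> /(Sle _ _ _ _ Sab Sab').
Qed.

Lemma computably_isomorphic_order L M :
  ce_prelattice M -> computably_isomorphic L M -> order_isomorphic L M.
Proof.
move=> HM [f [_ f_le f_surj _ _]]; exists (fun a b => lequiv M (f a) b).
have trans := lle_trans HM; have refl := lle_refl HM.
split=> // [a|a b a' b' [ab ba] [ab' ba']]; first by exists (f a).
rewrite f_le; split=> H.
  by apply: (trans _ _ _ ba); apply: (trans _ _ _ H).
by apply: (trans _ _ _ ab); apply: (trans _ _ _ H).
Qed.

Lemma order_isomorphic_least L M S :
  (forall b, exists a, S a b) ->
  (forall a b a' b', S a b -> S a' b' -> (lle L a a' <-> lle M b b')) ->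
  forall a b, S a b -> least L a -> least M b.
Proof.
by move=> SM Sle a b ab La t; have [c ct] := SM t; apply/(Sle _ _ _ _ ab ct).
Qed.

Lemma complemented_iso L M :
  order_isomorphic L M -> complemented L -> complemented M.
Proof.
move=> [S [SL SM Sle]] cL x; have [a ax] := SM x; have [a' [La Ga]] := cL a.
have [y a'y] := SL a'; exists y; split=> z.
  have [c cz] := SM z => /(Sle _ _ _ _ cz ax) ca /(Sle _ _ _ _ cz a'y) ca'.
  exact: (order_isomorphic_least SM Sle cz (La _ ca ca')).
have [c cz] := SM z => /(Sle _ _ _ _ ax cz) ca /(Sle _ _ _ _ a'y cz) ca' t.
by have [d dt] := SM t; apply/(Sle _ _ _ _ dt cz); apply: Ga.
Qed.

Lemma zero_divisors_iso L M :
  order_isomorphic L M -> zero_divisors L -> zero_divisors M.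
Proof.
move=> iso [a [b [Hab na nb]]]; have [S [SL SM Sle]] := iso.
have [x ax] := SL a; have [y bY] := SL b.
have least_back c z : S c z -> least M z -> least L c.
  move=> cz Lz t; have [w tw] := SL t.
  by apply/(Sle _ _ _ _ cz tw).
exists x, y; split.
- move=> z; have [c cz] := SM z.
  move=> /(Sle _ _ _ _ cz ax) ca /(Sle _ _ _ _ cz bY) cb.
  exact: (order_isomorphic_least SM Sle cz (Hab _ ca cb)).
- by move=> /(least_back _ _ ax).
by move=> /(least_back _ _ bY).
Qed.

Lemma order_distributive_iso L M :
  order_isomorphic L M -> order_distributive L -> order_distributive M.
Proof.
move=> [S [SL SM Sle]] dL x y z u w ux uyz xyw xzw.
have [a ax] := SM x; have [b bY] := SM y; have [c cz] := SM z.
have [p pu] := SM u; have [q qw] := SM w.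
apply/(Sle _ _ _ _ pu qw); apply: (dL a b c).
- by apply/(Sle _ _ _ _ pu ax).
- move=> t; have [t' tt] := SL t.
  move=> /(Sle _ _ _ _ bY tt) ? /(Sle _ _ _ _ cz tt) ?.
  by apply/(Sle _ _ _ _ pu tt); apply: uyz.
- move=> t; have [t' tt] := SL t.
  move=> /(Sle _ _ _ _ tt ax) ? /(Sle _ _ _ _ tt bY) ?.
  by apply/(Sle _ _ _ _ tt qw); apply: xyw.
move=> t; have [t' tt] := SL t.
move=> /(Sle _ _ _ _ tt ax) ? /(Sle _ _ _ _ tt cz) ?.
by apply/(Sle _ _ _ _ tt qw); apply: xzw.
Qed.

Lemma distributive_order L :
  ce_prelattice L -> distributive L -> order_distributive L.
Proof.
move=> HL dL x y z u w ux uyz xyw xzw.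
have trans := lle_trans HL; have refl := lle_refl HL.
have glb := lmeet_glb HL; have lub := ljoin_lub HL.
have [d _] := dL x y z.
have : lle L u (lmeet L x (ljoin L y z)).
  by apply/glb; split=> //; apply: uyz; have /lub[] := refl (ljoin L y z).
move=> /trans/(_ d)/trans; apply; apply/lub; split.
  by apply: xyw; have /glb[] := refl (lmeet L x y).
by apply: xzw; have /glb[] := refl (lmeet L x z).
Qed.

(** * Truth-value and Kripke models *)

(** Truth values under a valuation [v] of the generators, where the terms [timp]
    are generators too, with valuation [u]. *)
Definition prop_algebra (v u : nat -> nat -> Prop) : algebra Prop :=
  Algebra False True and or v (fun a b _ _ => u a b).

(** Truth values with material implication. *)
Definition classical_algebra (v : nat -> nat -> Prop) : algebra Prop :=
  Algebra False True and or v (fun _ _ P Q => P -> Q).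

(** Generators that stand for a computation with value 0 or 1 get that value as
    their truth value. *)
Definition admissible (v : nat -> nat -> Prop) : Prop :=
  forall e k, (phi e k 0 -> ~ v e k) /\ (phi e k 1 -> v e k).

(** The order of truth values. *)
Definition implies (P Q : Prop) : Prop := P -> Q.

Lemma interprets_implies (F : nat -> Prop) : ~ F 0 -> F 1 ->
  (forall x y, F (tmeet x y) <-> F x /\ F y) ->
  (forall x y, F (tjoin x y) <-> F x \/ F y) -> interprets implies F.
Proof.
move=> F0 F1 Fm Fj; rewrite /implies.
by split=> // *; rewrite ?Fm ?Fj; tauto.
Qed.

Lemma interprets_prop v u : interprets implies (term_eval (prop_algebra v u)).
Proof. by apply: interprets_implies => // *; rewrite teE. Qed.

Lemma interprets_classical v :
  interprets implies (term_eval (classical_algebra v)).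
Proof. by apply: interprets_implies => // *; rewrite teE. Qed.

Lemma free_laws_sound v u : admissible v -> forall x y,
  der false free_laws x y ->
  term_eval (prop_algebra v u) x -> term_eval (prop_algebra v u) y.
Proof.
move=> adm; apply: (der_sound (interprets_prop v u)) => //.
move=> x y [|[a [b [c [-> ->]]]]]; last by rewrite /implies !teE /=; tauto.
apply: gen_law_sound => e k ph; rewrite /implies !teE /=;
  by have := adm e k; tauto.
Qed.

Lemma boolean_laws_sound v : admissible v -> forall x y,
  der true boolean_laws x y ->
  term_eval (classical_algebra v) x -> term_eval (classical_algebra v) y.
Proof.
move=> adm; apply: (der_sound (interprets_classical v)) => //.
  by move=> _ x y z; rewrite /implies !teE /=; tauto.
move=> x y [|[a [-> ->]]]; last first.
  rewrite /implies !teE /= => _.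
  by case: (pselect (term_eval (classical_algebra v) a)); tauto.
apply: gen_law_sound => e k ph; rewrite /implies !teE /=;
  by have := adm e k; tauto.
Qed.

(** The least and the greatest admissible valuation. *)
Definition least_valuation (e k : nat) : Prop := phi e k 1.
Definition greatest_valuation (e k : nat) : Prop := ~ phi e k 0.

Lemma least_valuation_admissible : admissible least_valuation.
Proof. by move=> e k; split=> // ph0 ph1; have := phi_det ph0 ph1. Qed.

Lemma greatest_valuation_admissible : admissible greatest_valuation.
Proof. by move=> e k; split=> [? //|ph1 ph0]; have := phi_det ph0 ph1. Qed.

(** A generator that stands for a computation with value 2. *)
Definition undetermined : nat := tgen (encode CSucc) 1.

Lemma phi_undetermined y : phi (encode CSucc) 1 y -> y = 2.
Proof. by move/phi_det; apply; exists CSucc => //; constructor. Qed.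

(** * The Boolean and the Heyting pre-algebra *)

(** With relative pseudo-complementation, every semidecidable and consistent set
    of laws that includes those on generators yields a member of the class. *)
Lemma presented_ei_heyting Ax : sigma1_rel Ax -> ~ der true Ax 1 0 ->
  (forall x y, gen_law false x y -> Ax x y) ->
  ei_heyting (HeytingSig (presented true Ax) timp).
Proof.
move=> HAx ntriv gen.
have [bnd ei] : ei_prelattice (presented true Ax).
  apply: presented_ei => // e k y ph lt_y2.
  by have [] := gen_lawP (all := false) ph lt_y2; split; apply: gen.
have adj x y z : der true Ax z (timp x y) <-> der true Ax (tmeet z x) y.
  split; last exact: der_impI.
  move=> H; apply: (der_trans _ (der_impE _ x y isT)); apply: der_glb.
    exact: (der_trans (der_meetl _ _ _ _) H).
  exact: der_meetr.
split=> //; split=> //.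
  by apply: computable2P; apply: total_rec_timp;
    [apply: total_rec_fst | apply: total_rec_snd]; exact: total_rec_id.
suff mono x x' y y' : der true Ax x' x -> der true Ax y y' ->
    der true Ax (timp x y) (timp x' y').
  by move=> x x' y y' [? ?] [? ?]; split; apply: mono.
move=> xx yy; apply/adj; apply: (der_trans _ yy).
apply: (der_trans _ (der_impE _ x y isT)); apply: der_glb.
  exact: der_meetl.
exact: (der_trans (der_meetr _ _ _ _) xx).
Qed.

(** The Boolean pre-algebra, with implication and with negation as the
    additional operation. *)
Definition boolean_heyting : heyting_sig :=
  HeytingSig (presented true boolean_laws) timp.

Definition boolean_prealgebra : bool_sig :=
  BoolSig (presented true boolean_laws) (fun x => timp x 0).

(** The Heyting pre-algebra with no laws but those on generators. *)
Definition heyting_prealgebra : heyting_sig :=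
  HeytingSig (presented true (gen_law false)) timp.

Lemma boolean_ei_heyting : ei_heyting boolean_heyting.
Proof.
apply: presented_ei_heyting; first exact: sigma1_boolean_laws.
  by move/(boolean_laws_sound least_valuation_admissible); rewrite !teE; apply.
by left.
Qed.

Lemma boolean_ei : ei_boolean boolean_prealgebra.
Proof.
have [[bnd _ cong adj] ei] := boolean_ei_heyting.
have [_ distr] := ei_heyting_distributive boolean_ei_heyting.
split=> //; split=> //.
- have [c Hc] : total_rec (fun x => timp x 0).
    by apply: total_rec_timp; [exact: total_rec_id | exact: total_rec_const].
  by exists (encode c) => x; exists c.
- by move=> x x' xx; apply: cong => //; split; exact: der_refl.
move=> x; split; split; try exact: der_bot; try exact: der_top.
  apply: (der_trans _ (der_impE _ x 0 isT)).
  by apply: der_glb; [exact: der_meetr | exact: der_meetl].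
by apply: der_ax; right; exists x.
Qed.

Lemma boolean_complemented : complemented boolean_prealgebra.
Proof.
have [[[HB _] _ _ _ compl] _] := boolean_ei.
move=> x; exists (timp x 0); have [[m0 _] [_ j1]] := compl x; split=> z zx zy t.
  apply: (der_trans _ (der_bot _ _ _)); apply: (der_trans _ m0); exact: der_glb.
by apply: (der_trans (der_top _ _ _)); apply: (der_trans j1); exact: der_lub.
Qed.

Lemma boolean_zero_divisors : zero_divisors boolean_prealgebra.
Proof.
have bool_sound v := @boolean_laws_sound v.
exists undetermined, (timp undetermined 0); split.
- move=> z zx zy t; apply: (der_trans _ (der_bot _ _ _)).
  by apply: (der_trans _ (der_impE _ undetermined 0 isT)); apply: der_glb.
- move=> /(_ 0)/(bool_sound _ greatest_valuation_admissible).
  rewrite !teE; apply.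
  by move=> /phi_undetermined.
move=> /(_ 0)/(bool_sound _ least_valuation_admissible); rewrite !teE; apply.
by move=> /phi_undetermined.
Qed.

(** The Kripke model on two worlds [false] below [true]: a generator that no
    computation makes 0 or 1 is true at [true] only. *)
Definition kripke_algebra : algebra (bool -> Prop) :=
  Algebra (fun=> False) (fun=> True)
    (fun P Q w => P w /\ Q w) (fun P Q w => P w \/ Q w)
    (fun e k w => if w then greatest_valuation e k else least_valuation e k)
    (fun _ _ P Q w => (P w -> Q w) /\ (P true -> Q true)).

(** Truth of the term [x] at the world [w]. *)
Definition forces (w : bool) (x : nat) : Prop := term_eval kripke_algebra x w.

Lemma forces_mono x : forces false x -> forces true x.
Proof.
rewrite /forces; elim/term_ind: x => [||x y IHx IHy|x y IHx IHy|e k|x y _ _] //;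
  rewrite !teE /=; try tauto.
by have [_] := greatest_valuation_admissible e k.
Qed.

Lemma heyting_sound x y : der true (gen_law false) x y ->
  forall w, forces w x -> forces w y.
Proof.
move: x y; pose le (P Q : bool -> Prop) := forall w, P w -> Q w.
apply: (@der_sound true _ _ le (term_eval kripke_algebra)).
- split; rewrite /le.
  + by [].
  + by move=> x y z xy yz w xw; apply: yz; apply: xy.
  + by move=> x w; rewrite teE.
  + by move=> x w; rewrite !teE.
  + move=> x y z; rewrite /le teE /=; split=> [H|[H1 H2] w zw].
      by split=> w /H[].
    by split; [exact: H1 | exact: H2].
  + move=> x y z; rewrite /le teE /=; split=> [H|[H1 H2] w [/H1|/H2] //].
    by split=> w Hw; apply: H; [left | right].
- move=> _ x y z; rewrite /le !teE /=; split=> [H w [/H[]] //|H w zw].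
  split=> xw; apply: H; split=> //.
  by case: w zw => // /forces_mono.
apply: gen_law_sound => e k ph; rewrite /le !teE /=;
  have := least_valuation_admissible e k;
  have := greatest_valuation_admissible e k.
  move=> [g _] [l _]; split=> -[] //= H;
    first [by case: (g ph) | by case: (l ph)].
by move=> [_ g] [_ l]; split=> -[] //= _; first [exact: g | exact: l].
Qed.

Lemma heyting_ei : ei_heyting heyting_prealgebra.
Proof.
apply: presented_ei_heyting => //; first exact: sigma1_gen_law.
by move/heyting_sound/(_ true); apply.
Qed.

Lemma heyting_not_complemented : ~ complemented heyting_prealgebra.
Proof.
move=> /(_ undetermined)[y [Hm Hj]].
have /heyting_sound/(_ false) :
    der true (gen_law false) 1 (tjoin undetermined y).
  by apply: Hj; [exact: der_joinl | exact: der_joinr].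
rewrite /forces !teE /= => -[//|/phi_undetermined //|yf].
have /heyting_sound/(_ true) :
    der true (gen_law false) (tmeet undetermined y) 0.
  by apply: Hm; [exact: der_meetl | exact: der_meetr].
rewrite /forces !teE /=; apply; split; last exact: forces_mono.
by move/phi_undetermined.
Qed.

(** * The free distributive pre-lattice *)

Definition free_prelattice : lat_sig := presented false free_laws.

Lemma free_ei : ei_prelattice free_prelattice.
Proof.
apply: presented_ei; first exact: sigma1_free_laws.
  move/(@free_laws_sound _ (fun _ _ => True) least_valuation_admissible).
  by rewrite !teE; apply.
move=> e k y ph lt_y2; have [? ?] := gen_lawP (all := false) ph lt_y2.
by split; left.
Qed.

Lemma free_distr : distributive free_prelattice.
Proof. by apply: der_distributive; right. Qed.

(** A term that is false under the greatest admissible valuation is 0. *)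
Lemma free_zero x :
  term_eval (prop_algebra greatest_valuation (fun _ _ => True)) x \/
  der false free_laws x 0.
Proof.
elim/term_ind: x => [||x y IHx IHy|x y IHx IHy|e k|x y _ _]; rewrite ?teE /=.
- by right; exact: der_refl.
- by left.
- case: IHx => [Hx|x0]; last by right; exact: der_trans (der_meetl _ _ _ _) x0.
  case: IHy => [Hy|y0]; last by right; exact: der_trans (der_meetr _ _ _ _) y0.
  by left.
- case: IHx => [Hx|x0]; first by left; left.
  case: IHy => [Hy|y0]; first by left; right.
  by right; apply: der_lub.
- case: (pselect (phi e k 0)) => ph; last by left.
  by right; apply: der_ax; left; have [] := gen_lawP (all := false) ph isT.
by left.
Qed.

Lemma free_no_zero_divisors : ~ zero_divisors free_prelattice.
Proof.
have zero_least x : der false free_laws x 0 -> least free_prelattice x.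
  by move=> x0 t; apply: (der_trans x0); exact: der_bot.
move=> [x [y [Hxy nx ny]]].
have : der false free_laws (tmeet x y) 0.
  by apply: Hxy; [exact: der_meetl | exact: der_meetr].
move/(@free_laws_sound _ (fun _ _ => True) greatest_valuation_admissible).
rewrite !teE /=; apply.
case: (free_zero x) => [x1|/zero_least//].
by case: (free_zero y) => [y1|/zero_least//].
Qed.

Lemma count_iotaS (p : pred nat) x :
  count p (iota 0 x.+1) = count p (iota 0 x) + p x.
Proof. by rewrite -addn1 iotaD count_cat /= addn0. Qed.

Lemma count_iota_mono (p : pred nat) x y :
  x <= y -> count p (iota 0 x) <= count p (iota 0 y).
Proof. by move=> le_xy; rewrite -(subnKC le_xy) iotaD count_cat leq_addr. Qed.

Lemma count_iota_inj (p : pred nat) x y : p x -> p y ->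
  count p (iota 0 x) = count p (iota 0 y) -> x = y.
Proof.
have lt a b : p a -> a < b -> count p (iota 0 a) < count p (iota 0 b).
  by move=> pa /(count_iota_mono p); rewrite count_iotaS pa addn1.
by move=> px py; case: (ltngtP x y) => // [/(lt _ _ px)|/(lt _ _ py)]; lia.
Qed.

(** The members of an infinite set can be numbered in increasing order. *)
Lemma count_iota_surj (p : pred nat) : (forall n, exists2 x, n <= x & p x) ->
  forall n, exists2 x, p x & count p (iota 0 x) = n.
Proof.
move=> inf n.
have ex : exists x, n < count p (iota 0 x).
  elim: n => [|n [x Hx]].
    by have [x _ px] := inf 0; exists x.+1; rewrite count_iotaS px addn1.
  have [y le_xy py] := inf x; exists y.+1.
  by rewrite count_iotaS py addn1 ltnS (leq_trans Hx) ?count_iota_mono.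
case: (ex_minnP ex) => -[//|x]; rewrite count_iotaS => Hx Hmin.
have : ~~ (n < count p (iota 0 x)) by apply/negP => /Hmin; lia.
by exists x; case: (p x) Hx => //=; lia.
Qed.

(** The generators that the laws do not identify with 0 or 1. *)
Definition free_generator (x : nat) : bool :=
  `[< (exists e k, [/\ x = tgen e k, ~ phi e k 0 & ~ phi e k 1]) \/
      exists a b, x = timp a b >].

(** The position of [x] in the increasing list of the free generators. *)
Definition generator_rank (x : nat) : nat := count free_generator (iota 0 x).

Lemma free_generator_imp a b : free_generator (timp a b).
Proof. by apply/asboolP; right; exists a, b. Qed.

Lemma free_generator_gen e k : ~ phi e k 0 -> ~ phi e k 1 ->
  free_generator (tgen e k).
Proof. by move=> ? ?; apply/asboolP; left; exists e, k. Qed.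

Lemma generator_rank_surj n :
  exists2 x, free_generator x & generator_rank x = n.
Proof.
apply: count_iota_surj => m; exists (timp m 0); last exact: free_generator_imp.
exact: leq_timp.
Qed.

(** The lattice [M], with values [g] and [u] of the generators [tgen] and
    [timp]. *)
Definition lattice_algebra d (M : tbDistrLatticeType d)
    (g u : nat -> nat -> M) : algebra M :=
  Algebra Order.bottom Order.top Order.meet Order.join g (fun a b _ _ => u a b).

Lemma interprets_lattice d (M : tbDistrLatticeType d) (g u : nat -> nat -> M) :
  interprets (fun P Q : M => (P <= Q)%O) (term_eval (lattice_algebra g u)).
Proof.
split.
- by move=> x; exact: lexx.
- by move=> x y z; exact: le_trans.
- by move=> x; rewrite teE; exact: le0x.
- by move=> x; rewrite teE; exact: lex1.
- by move=> x y z; rewrite teE /= lexI; split=> [/andP//|?]; apply/andP.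
by move=> x y z; rewrite teE /= leUx; split=> [/andP//|?]; apply/andP.
Qed.

Theorem free_free : free_distributive free_prelattice.
Proof.
split; first exact: free_distr.
have /choice[g Hg] : forall n, exists x,
    free_generator x /\ generator_rank x = n.
  by move=> n; have [x] := generator_rank_surj n; exists x.
have g_rank x : free_generator x -> g (generator_rank x) = x.
  move=> fx; have [fg rg] := Hg (generator_rank x).
  exact: count_iota_inj fg fx rg.
exists g; split.
  move=> m n [/= le_mn _].
  suff e : g n = g m by rewrite -(proj2 (Hg m)) -(proj2 (Hg n)) e.
  (* The valuation that makes [g m] the only true free generator. *)
  pose v e k := phi e k 1 \/ tgen e k = g m.
  pose u a b := timp a b = g m.
  have adm : admissible v.
    move=> e k; split=> [ph [ph1|E]|ph]; last by left.
      by have := phi_det ph ph1.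
    have [/asboolP[[e' [k' [E' n0 _]]]|[a [b E']]] _] := Hg m.
      by rewrite E' in E; case/tgen_inj: E => ? ?; subst.
    by rewrite E' in E; have [_ _ _ _ [_ /(_ E)]] := term_disjoint e k a b.
  have : term_eval (prop_algebra v u) (g m).
    have [/asboolP[[e [k [E _ _]]]|[a [b E]]] _] := Hg m.
      by rewrite E teE /= /v E; right.
    by rewrite E teE /= /u.
  move/(free_laws_sound adm le_mn).
  have [/asboolP[[e [k [E _ n1]]]|[a [b E]]] _] := Hg n.
    by rewrite E teE => -[].
  by rewrite E teE.
move=> d M h; split; last first.
  move=> F G [Feq Fm Fj F0 F1] [Geq Gm Gj G0 G1] Fh Gh x.
  have FG_free y : free_generator y -> F y = G y.
    by move=> /g_rank <-; rewrite Fh Gh.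
  elim/term_ind: x => [||x y IHx IHy|x y IHx IHy|e k|x y _ _].
  - by rewrite F0 G0.
  - by rewrite F1 G1.
  - by rewrite [LHS]Fm [RHS]Gm IHx IHy.
  - by rewrite [LHS]Fj [RHS]Gj IHx IHy.
  - have eqv i : phi e k i -> i < 2 -> lequiv free_prelattice (tgen e k) i.
      move=> ph Hi; have [? ?] := gen_lawP (all := false) ph Hi.
      by split; apply: der_ax; left.
    have [ph0|n0] := pselect (phi e k 0).
      by rewrite (Feq _ _ (eqv _ ph0 isT)) (Geq _ _ (eqv _ ph0 isT)) F0 G0.
    have [ph1|n1] := pselect (phi e k 1).
      by rewrite (Feq _ _ (eqv _ ph1 isT)) (Geq _ _ (eqv _ ph1 isT)) F1 G1.
    by apply/FG_free/free_generator_gen.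
  exact/FG_free/free_generator_imp.
pose gv e k : M := if `[< phi e k 0 >] then Order.bottom
  else if `[< phi e k 1 >] then Order.top else h (generator_rank (tgen e k)).
pose F := term_eval
  (lattice_algebra gv (fun a b => h (generator_rank (timp a b)))).
have gv0 e k : phi e k 0 -> gv e k = Order.bottom.
  by move=> ph; rewrite /gv asboolT.
have gv1 e k : phi e k 1 -> gv e k = Order.top.
  by move=> ph; rewrite /gv asboolF ?asboolT // => ph0; have := phi_det ph ph0.
exists F.
  have mono x y : der false free_laws x y -> (F x <= F y)%O.
    move: x y; apply: (der_sound (interprets_lattice _ _)) => //.
    move=> x y [|[a [b [c [-> ->]]]]].
      apply: (gen_law_sound (le := fun P Q : M => (P <= Q)%O)) => e k ph.
        by rewrite !teE /= gv0.
      by rewrite !teE /= gv1.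
    by rewrite !teE /= meetUr.
  split; try by move=> *; rewrite /F !teE.
  by move=> x y [xy yx]; apply: le_anti; rewrite !mono.
move=> n; have [/asboolP[[e [k [E n0 n1]]]|[a [b E]]] rn] := Hg n.
  by rewrite /F E teE /= /gv !asboolF // -E rn.
by rewrite /F E teE /= -E rn.
Qed.

Lemma free_ei_free : ei_free_distributive free_prelattice.
Proof. by split; [exact: free_ei | exact: free_free]. Qed.

(** * The precomplete distributive pre-lattice *)

Definition precomplete_prelattice : lat_sig := presented false precomplete_laws.

(** The least truth assignment to terms in which [tgen e k] has the truth value
    of the term that it computes, given the true implications [D].  It exists
    although the computed term is arbitrary, because terms are monotone. *)
Inductive true_term (D : nat -> nat -> Prop) : nat -> Prop :=
| true_top : true_term D 1
| true_meet x y : true_term D x -> true_term D y -> true_term D (tmeet x y)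
| true_joinl x y : true_term D x -> true_term D (tjoin x y)
| true_joinr x y : true_term D y -> true_term D (tjoin x y)
| true_gen e k x : phi e k x -> true_term D x -> true_term D (tgen e k)
| true_imp x y : D x y -> true_term D (timp x y).

Lemma true_termE D :
  [/\ ~ true_term D 0,
      forall x y, true_term D (tmeet x y) <-> true_term D x /\ true_term D y,
      forall x y, true_term D (tjoin x y) <-> true_term D x \/ true_term D y,
      forall e k x, phi e k x -> (true_term D (tgen e k) <-> true_term D x)
    & forall x y, true_term D (timp x y) <-> D x y].
Proof.
have disj := term_disjoint.
split.
- by move E: 0 => t H; case: H E.
- move=> x y; split=> [|[? ?]]; last by constructor.
  move E: (tmeet x y) => t H.
  case: H E => [|x' y' ? ?|x' y' _|x' y' _|e k x' _ _|x' y' _] E //.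
  + by case/tmeet_inj: E => -> ->.
  + by have [] := disj x y x' y'.
  + by have [] := disj x y x' y'.
  + by have [] := disj x y e k.
  + by have [] := disj x y x' y'.
- move=> x y; split=> [|[?|?]]; [|exact: true_joinl|exact: true_joinr].
  move E: (tjoin x y) => t H.
  case: H E => [|x' y' _ _|x' y' ?|x' y' ?|e k x' _ _|x' y' _] E //.
  + by move/esym: E; have [] := disj x' y' x y.
  + by case/tjoin_inj: E => -> _; left.
  + by case/tjoin_inj: E => _ ->; right.
  + by have [] := disj x y e k.
  + by have [_ _ _ _ []] := disj x y x' y'.
- move=> e k x ph; split=> [|?]; last exact: (true_gen ph).
  move E: (tgen e k) => t H.
  case: H E => [|x' y' _ _|x' y' _|x' y' _|e' k' x' ph' ?|x' y' _] E //.
  + by move/esym: E; have [] := disj x' y' e k.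
  + by move/esym: E; have [] := disj x' y' e k.
  + by move/esym: E; have [] := disj x' y' e k.
  + by case/tgen_inj: E => ? ?; subst; rewrite (phi_det ph ph').
  + by have [_ _ _ _ []] := disj e k x' y'.
move=> x y; split=> [|?]; last by constructor.
move E: (timp x y) => t H.
case: H E => [|x' y' _ _|x' y' _|x' y' _|e k x' _ _|x' y' ?] E //.
- by move/esym: E; have [] := disj x' y' x y.
- by move/esym: E; have [_ _ _ _ []] := disj x' y' x y.
- by move/esym: E; have [_ _ _ _ []] := disj x' y' x y.
- by move/esym: E; have [_ _ _ _ []] := disj e k x y.
by case/timp_inj: E => -> ->.
Qed.

Lemma true_term_mono (D D' : nat -> nat -> Prop) x :
  (forall a b, D a b -> D' a b) -> true_term D x -> true_term D' x.
Proof.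
move=> DD; elim=> {x} [|a b _ Da _ Db|a b _ Da|a b _ Db|e k a ph _ Da|a b Dab].
- exact: true_top.
- exact: true_meet.
- exact: true_joinl.
- exact: true_joinr.
- exact: (true_gen ph).
by apply: true_imp; exact: DD.
Qed.

Lemma precomplete_sound D : ~ (D 0 0 /\ D 0 1) ->
  forall x y, der false precomplete_laws x y -> true_term D x -> true_term D y.
Proof.
move=> HD; have [T0 Tm Tj Tg Ti] := true_termE D.
apply: (der_sound (interprets_implies T0 (true_top D) Tm Tj)) => //.
rewrite /implies => x y [[e [k [i [_ ph]]]]|[[a [b [c [-> ->]]]]|[-> ->]]].
- by case=> -[-> ->]; rewrite (Tg _ _ _ ph).
- by rewrite !(Tm, Tj); tauto.
by rewrite Tm !Ti.
Qed.

Lemma precomplete_class : ce_precomplete_distributive precomplete_prelattice.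
Proof.
have ntriv : ~ der false precomplete_laws 1 0.
  move/(@precomplete_sound (fun _ _ => False)) => H.
  have [T0 _ _ _ _] := true_termE (fun _ _ => False).
  by apply/T0/H; [case | exact: true_top].
split.
- by apply: presented_bounded => //; exact: sigma1_precomplete_laws.
- by apply: der_distributive; right; left.
split; first by exists 0, 1 => -[].
exists tgen.
  by apply: computable2P; apply: total_rec_tgen;
    [apply: total_rec_fst | apply: total_rec_snd]; exact: total_rec_id.
move=> e x y ph; have [? ?] := gen_lawP (all := true) ph isT.
by split; apply: der_ax; left.
Qed.

Lemma precomplete_zero_divisors : zero_divisors precomplete_prelattice.
Proof.
have not_least D : ~ (D 0 0 /\ D 0 1) -> forall i, D 0 i ->
    ~ least precomplete_prelattice (tconst i).
  move=> HD i Di /(_ 0)/(precomplete_sound HD).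
  have [T0 _ _ _ Ti] := true_termE D.
  by move=> H; apply/T0/H/Ti.
exists (tconst 0), (tconst 1); split.
- move=> z z0 z1 t; apply: (der_trans _ (der_bot _ _ _)).
  apply: (der_trans (der_glb z0 z1)); apply: der_ax.
  by right; right.
- by apply: (not_least (fun _ i => i = 0)) => // -[].
by apply: (not_least (fun _ i => i = 1)) => // -[].
Qed.

Lemma precomplete_not_complemented : ~ complemented precomplete_prelattice.
Proof.
move=> /(_ (tconst 2))[y [Hm Hj]].
(* If [y] is a complement, it is true where [tconst 2] is false, hence by
   monotonicity also where [tconst 2] is true. *)
pose D0 (a b : nat) := False; pose D1 (a b : nat) := b = 2.
have [T0 Tm Tj Tg Ti] := true_termE D0; have [U0 Um Uj Ug Ui] := true_termE D1.
have : true_term D0 (tjoin (tconst 2) y).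
  apply: (@precomplete_sound D0 _ 1); [by case| |exact: true_top].
  by apply: Hj; [exact: der_joinl | exact: der_joinr].
rewrite Tj Ti => -[//|y0]; apply: U0.
apply: (@precomplete_sound D1 _ (tmeet (tconst 2) y)); first by case.
  by apply: Hm; [exact: der_meetl | exact: der_meetr].
by rewrite Um Ui; split=> //; apply: true_term_mono y0.
Qed.

(** * The non-distributive pre-lattice *)

Definition nondistributive_prelattice : lat_sig :=
  presented false (gen_law false).

(** The five-element modular non-distributive lattice. *)
Inductive m3 : Type := M3bot | M3a | M3b | M3c | M3top.

Definition m3_le (x y : m3) : bool :=
  match x, y with
  | M3bot, _ | _, M3top | M3a, M3a | M3b, M3b | M3c, M3c => true
  | _, _ => false
  end.

Definition m3_meet (x y : m3) : m3 :=
  match x, y with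
  | M3top, z | z, M3top => z
  | M3a, M3a => M3a | M3b, M3b => M3b | M3c, M3c => M3c
  | _, _ => M3bot
  end.

Definition m3_join (x y : m3) : m3 :=
  match x, y with
  | M3bot, z | z, M3bot => z
  | M3a, M3a => M3a | M3b, M3b => M3b | M3c, M3c => M3c
  | _, _ => M3top
  end.

(** The values of [tconst 0], [tconst 1] and [tconst 2] are the three atoms. *)
Definition m3_algebra : algebra m3 :=
  Algebra M3bot M3top m3_meet m3_join
    (fun e k => if `[< phi e k 1 >] then M3top else M3bot)
    (fun _ i _ _ => match i with 0 => M3a | 1 => M3b | _ => M3c end).

Lemma m3_sound x y : der false (gen_law false) x y ->
  m3_le (term_eval m3_algebra x) (term_eval m3_algebra y).
Proof.
move: x y; apply: (@der_sound _ _ _ m3_le (term_eval m3_algebra)) => //.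
  split.
  - by move=> x; case: (term_eval _ x).
  - move=> x y z.
    by case: (term_eval _ x); case: (term_eval _ y); case: (term_eval _ z).
  - by move=> x; rewrite teE.
  - by move=> x; rewrite teE /=; case: (term_eval _ x).
  - move=> x y z; rewrite teE /=.
    by case: (term_eval _ x); case: (term_eval _ y); case: (term_eval _ z);
      split=> // -[].
  move=> x y z; rewrite teE /=.
  by case: (term_eval _ x); case: (term_eval _ y); case: (term_eval _ z);
    split=> // -[].
apply: (gen_law_sound (le := m3_le) (F := term_eval m3_algebra)) => e k ph;
  rewrite !teE /=.
  by rewrite asboolF // => ph1; have := phi_det ph ph1.
by rewrite asboolT.
Qed.

Lemma nondistributive_ei_prelattice : ei_prelattice nondistributive_prelattice.
Proof.
apply: presented_ei; first exact: sigma1_gen_law.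
  by move/m3_sound; rewrite !teE.
by move=> e k y ph lt_y2; exact: gen_lawP.
Qed.

Lemma nondistributive_not_order :
  ~ order_distributive nondistributive_prelattice.
Proof.
move=> dist.
suff der_distr x y z : der false (gen_law false) (tmeet x (tjoin y z))
    (tjoin (tmeet x y) (tmeet x z)).
  have ev i : term_eval m3_algebra (tconst i) =
      match i with 0 => M3a | 1 => M3b | _ => M3c end by exact: term_eval_imp.
  move: (ev 0) (ev 1) (ev 2) (der_distr (tconst 0) (tconst 1) (tconst 2)).
  move: (tconst 0) (tconst 1) (tconst 2) => x y z ex ey ez /m3_sound.
  by rewrite term_eval_join !term_eval_meet term_eval_join ex ey ez.
apply: (dist x y z) => [|t yt zt|t tx ty|t tx tz].
- exact: der_meetl.
- by apply: (der_trans (der_meetr _ _ _ _)); apply: der_lub.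
- by apply: (der_trans _ (der_joinl _ _ _ _)); apply: der_glb.
by apply: (der_trans _ (der_joinr _ _ _ _)); apply: der_glb.
Qed.

Lemma nondistributive_ei : ei_nondistributive nondistributive_prelattice.
Proof.
split; first exact: nondistributive_ei_prelattice.
have [[HN _] _] := nondistributive_ei_prelattice.
by move/(distributive_order HN)/nondistributive_not_order.
Qed.

(** * The separation of the classes *)

(** A property of the order that is preserved by isomorphisms separates, in both
    directions, a pre-lattice that has it from one that does not. *)
Lemma invariant_not_isomorphic (P : lat_sig -> Prop) L M :
  (forall L M, order_isomorphic L M -> P L -> P M) ->
  ce_prelattice L -> ce_prelattice M -> P L -> ~ P M ->
  ~ computably_isomorphic L M /\ ~ computably_isomorphic M L.
Proof.
move=> Piso HL HM PL PM; split.
  by move=> /(computably_isomorphic_order HM)/Piso/(_ PL).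
by move=> /(computably_isomorphic_order HL)/order_isomorphic_sym/Piso/(_ PL).
Qed.

Theorem theorem58 :
  (forall H : heyting_sig, ei_heyting H -> ei_distributive H) /\
  (forall L : lat_sig, ei_free_distributive L -> ei_distributive L) /\
  (forall L : lat_sig, ce_precomplete_distributive L -> ei_distributive L) /\
  (forall c d : class_name, c <> d ->
     exists (A : signature c) (B : signature d),
       in_class c A /\ in_class d B /\
       ~ computably_isomorphic (lattice_reduct c A) (lattice_reduct d B)).
Proof.
split; first exact: ei_heyting_distributive.
split; first by move=> L [Lei [Ld _]].
split.
  move=> L [bnd Ld pre]; split=> //; split=> //.
  exact: precomplete_ei_bounds.
have inB := boolean_ei; have inH := heyting_ei; have inBH := boolean_ei_heyting.
have inF := free_ei_free; have inP := precomplete_class.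
have inN := nondistributive_ei.
have [[[latB _] dB _ _ _] _] := inB; have [[[latH _] _ _ _] _] := inH.
have [[[latF _] _] [dF _]] := inF; have [[latP _] dP _] := inP.
have [[[latN _] _] _] := inN.
have oN := nondistributive_not_order.
have oB := distributive_order latB dB; have oF := distributive_order latF dF.
have oP := distributive_order latP dP.
have [BH HB] := invariant_not_isomorphic complemented_iso latB latH
  boolean_complemented heyting_not_complemented.
have [BF FB] := invariant_not_isomorphic zero_divisors_iso latB latF
  boolean_zero_divisors free_no_zero_divisors.
have [BP PB] := invariant_not_isomorphic complemented_iso latB latP
  boolean_complemented precomplete_not_complemented.
have [BN NB] := invariant_not_isomorphic order_distributive_iso latB latN oB oN.
have [PF FP] := invariant_not_isomorphic zero_divisors_iso latP latF
  precomplete_zero_divisors free_no_zero_divisors.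
have [FN NF] := invariant_not_isomorphic order_distributive_iso latF latN oF oN.
have [PN NP] := invariant_not_isomorphic order_distributive_iso latP latN oP oN.
case=> -[] // _.
- by exists boolean_prealgebra, heyting_prealgebra.
- by exists boolean_prealgebra, free_prelattice.
- by exists boolean_prealgebra, precomplete_prelattice.
- by exists boolean_prealgebra, nondistributive_prelattice.
- by exists heyting_prealgebra, boolean_prealgebra.
- by exists boolean_heyting, free_prelattice.
- by exists boolean_heyting, precomplete_prelattice.
- by exists boolean_heyting, nondistributive_prelattice.
- by exists free_prelattice, boolean_prealgebra.
- by exists free_prelattice, boolean_heyting.
- by exists free_prelattice, precomplete_prelattice.
- by exists free_prelattice, nondistributive_prelattice.
- by exists precomplete_prelattice, boolean_prealgebra.
- by exists precomplete_prelattice, boolean_heyting.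
- by exists precomplete_prelattice, free_prelattice.
- by exists precomplete_prelattice, nondistributive_prelattice.
- by exists nondistributive_prelattice, boolean_prealgebra.
- by exists nondistributive_prelattice, boolean_heyting.
- by exists nondistributive_prelattice, free_prelattice.
by exists nondistributive_prelattice, precomplete_prelattice.
Qed.
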